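(* Assume $\beta_1\beta_2=(1-\alpha_1)(1-\alpha_2)$. If $0\le\alpha_1,\alpha_2<1$ are not both zero, then (S) has no eigenvalue $(\lambda,\mu)$ in $$\big(\overline{\mathcal{R}_1}\setminus\mathcal{C}_1\big)\cup-\big(\overline{\mathcal{R}_1}\setminus\mathcal{C}_1\big)\cup\big(\overline{\mathcal{R}_2}\setminus\mathcal{C}_2\big)\cup-\big(\overline{\mathcal{R}_2}\setminus\mathcal{C}_2\big).$$
   Context: Let $n\ge1$, $p>n$, and let $\Omega\subset\mathbb{R}^n$ be a bounded open set with $C^{1,1}$ boundary and outward unit normal $\nu$. For $l=1,2$ let $\mathcal{L}_l=a^l_{ij}(x)\partial_{ij}+b^l_i(x)\partial_i+c_l(x)$ (summation convention), where $a^l_{ij}\in C(\overline\Omega)$, $b^l_i,c_l\in L^\infty(\Omega)$, and there are constants $c_0,C_0,T>0$ with $c_0|\xi|^2\le a^l_{ij}(x)\xi_i\xi_j\le C_0|\xi|^2$ and $|b^l_i(x)|,|c_l(x)|\le T$ for all $x\in\Omega$, $\xi\in\mathbb{R}^n$ and all $i$. Standing assumption: each $\mathcal{L}_l$ satisfies the scalar weak maximum principle in $\Omega$ (if $w\in W^{2,p}(\Omega)$, $\mathcal{L}_lw\le0$ a.e. in $\Omega$ and $w\ge0$ on $\partial\Omega$, then $w\ge0$ in $\Omega$) and the scalar strong maximum principle in $\Omega$ (for such $w$, either $w\equiv0$ in $\Omega$, or $w>0$ in $\Omega$ and $\partial_\nu w(x_0)<0$ at every $x_0\in\partial\Omega$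 with $w(x_0)=0$). Let $a,b\in L^p(\Omega)$ with $\operatorname{ess\,inf}_\Omega a>0$ and $\operatorname{ess\,inf}_\Omega b>0$. Let $\beta_1,\beta_2>0$. Convention: for $\gamma>0$, $|w|^{\gamma-1}w$ is the signed power ($0$ where $w=0$); for $\gamma=0$ the factor $|w|^{\gamma-1}w$ is read as the constant $1$. Equations hold a.e. The system (S) with parameters $(\lambda,\mu)\in\mathbb{R}^2$ is $$-\mathcal{L}_1u=\lambda a(x)|u|^{\alpha_1-1}u|v|^{\beta_1-1}v,\quad -\mathcal{L}_2v=\mu b(x)|v|^{\alpha_2-1}v|u|^{\beta_2-1}u\ \text{ in }\Omega,\qquad u=v=0\ \text{ on }\partial\Omega.$$ $(\lambda,\mu)\in\mathbb{R}^2$ is an eigenvalue of (S) if (S) has a nontrivial strong solution $(\varphi,\psi)\in(W^{2,p}(\Omega))^2$; it is a principal eigenvalue if it has such a solution with $\varphi,\psi>0$ in $\Omega$. Principal curve: $\mathcal{C}_1$ is the set of principal eigenvalues of (S); it is known that $\mathcal{C}_1=\{(\lambda,\mu)\in(0,\infty)^2:\lambda^{1/\sqrt{\beta_1(1-\alpha_1)}}\mu^{1/\sqrt{\beta_2(1-\alpha_2)}}=\Lambda_0\}$ for some constant $\Lambda_0>0$. $\mathcal{R}_1$ is the open region of the first quadrant below $\mathcal{C}_1$ (same expression with $<\Lambda_0$). $\mathcal{C}_2:=\{(\lambda,\mu):(\lambda,-\mu)\in\mathcal{C}_1\}$, and $\mathcal{R}_2:=\{(\lambda,\mu):(\lambda,-\mu)\in\mathcal{R}_1\}$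 is the open region of the fourth quadrant above $\mathcal{C}_2$. For $E\subset\mathbb{R}^2$, $-E=\{-x:x\in E\}$. *)

(* Defs.v *)
From HB Require Import structures.
From mathcomp Require Import all_boot all_order all_algebra.
From mathcomp Require Import all_classical all_reals all_analysis.
From mathcomp Require Import ess_sup_inf.

Set Implicit Arguments.
Unset Strict Implicit.
Unset Printing Implicit Defensive.

Import Order.TTheory GRing.Theory Num.Theory.
Import numFieldNormedType.Exports.

Local Open Scope classical_set_scope.
Local Open Scope ring_scope.

(* The ambient space is R^(n+1), so that the dimension is at least 1. *)

Section LebesgueMeasure.
Context {R : realType} {n : nat}.
Local Notation E := 'rV[R]_n.+1.
Local Open Scope ereal_scope.

Definition box (ab : E * E) : set E :=
  [set x | forall i, (ab.1 0 i < x 0 i < ab.2 0 i)%R].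

Definition box_vol (ab : E * E) : \bar R :=
  (\prod_i Num.max 0 (ab.2 0 i - ab.1 0 i))%R%:E.

Definition box_cover (A : set E) : set (nat -> E * E) :=
  [set F | A `<=` \bigcup_k box (F k)].

Definition lebesgue_outer (A : set E) : \bar R :=
  ereal_inf [set \sum_(k <oo) box_vol (F k) | F in box_cover A].

Lemma box_vol_ge0 ab : 0 <= box_vol ab.
Proof. by rewrite lee_fin; apply: prodr_ge0 => i _; rewrite le_max lexx. Qed.

Lemma box_vol00 : box_vol (0%R, 0%R) = 0.
Proof. by rewrite /box_vol big_ord_recl !mxE subrr maxxx mul0r. Qed.

Lemma lebesgue_outer_ge0 A : 0 <= lebesgue_outer A.
Proof.
apply: le_ereal_inf_tmp => _ [F _ <-].
by apply: nneseries_ge0 => k _ _; exact: box_vol_ge0.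
Qed.

Lemma lebesgue_outer0 : lebesgue_outer set0 = 0.
Proof.
apply/eqP; rewrite eq_le lebesgue_outer_ge0 andbT.
apply: ereal_inf_lbound; exists (fun=> (0%R, 0%R)); first by [].
by rewrite eseries0// => k _ _; exact: box_vol00.
Qed.

Lemma le_lebesgue_outer : {homo lebesgue_outer : A B / A `<=` B >-> A <= B}.
Proof.
move=> A B AB; apply: ereal_inf_le_tmp => _ [F BF <-].
by exists F => //; exact: subset_trans AB BF.
Qed.

Lemma lebesgue_outer_sigma_subadditive : sigma_subadditive lebesgue_outer.
Proof.
move=> A; have [[i ioo]|] := pselect (exists i, lebesgue_outer (A i) = +oo).
  rewrite (eseries_pinfty _ _ ioo) ?leey// => k _.
  by rewrite -ltNye (lt_le_trans _ (lebesgue_outer_ge0 _)).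
rewrite -forallNE => Aoo.
suff add2e (e : {posnum R}) : lebesgue_outer (\bigcup_k A k) <=
    \sum_(i <oo) lebesgue_outer (A i) + e%:num%:E.
  by apply/lee_addgt0Pr => _/posnumP[].
rewrite (le_trans _ (epsilon_trick _ _ _))//; last first.
  by move=> k; exact: lebesgue_outer_ge0.
pose P k (F : nat -> E * E) := box_cover (A k) F /\
  \sum_(j <oo) box_vol (F j) <=
  lebesgue_outer (A k) + (e%:num / (2 ^ k.+1)%:R)%:E.
have [G PG] : {G : nat -> nat -> E * E & forall k, P k (G k)}.
  apply: (@choice _ _ P) => k; rewrite /P.
  have fk : lebesgue_outer (A k) \is a fin_num.
    by rewrite ge0_fin_numE ?lebesgue_outer_ge0// ltey; apply/eqP; exact: Aoo.
  have ek : (0 < e%:num / (2 ^ k.+1)%:R)%R by [].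
  have [_ [F AF <-] Fk] := lb_ereal_inf_adherent ek fk.
  by exists F; split => //; exact: ltW.
have G_ge0 x : 0 <= (box_vol \o uncurry G) x by exact: box_vol_ge0.
apply: (@le_trans _ _ (\esum_(i in setT) (box_vol \o uncurry G) i)).
  apply: ereal_inf_lbound => /=.
  have /card_esym/ppcard_eqP[f] := card_nat2.
  exists (uncurry G \o f).
    move=> t [i _ /((PG i).1 t)[j _ Gt]].
    by exists (f^-1%FUN (i, j)) => //=; rewrite invK ?inE.
  rewrite -(esum_pred_image (box_vol \o uncurry G) _ xpredT) ?[fun=> _]set_true//.
  by rewrite image_eq.
rewrite (_ : esum _ _ = \sum_(i <oo) \sum_(j <oo) box_vol (G i j)); last first.
  pose J : nat -> set (nat * nat) := fun i => [set (i, j) | j in setT].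
  rewrite (_ : setT = \bigcup_k J k); last first.
    by rewrite predeqE => -[a b]; split => // _; exists a => //; exists b.
  rewrite esum_bigcupT /=; last 2 first.
    - apply/trivIsetP => i j _ _ ij.
      rewrite predeqE => -[k m] /=; split => //= -[] [_] _ [<-{k} _].
      by move=> [m' _] [] /esym/eqP; rewrite (negbTE ij).
    - by move=> ?; exact: G_ge0.
  rewrite -(image_id [set: nat]) -fun_true esum_pred_image//; last first.
    by move=> k _; apply: esum_ge0 => x _; exact: box_vol_ge0.
  apply: eq_eseriesr => /= j _.
  rewrite -(esum_pred_image (box_vol \o uncurry G) (pair j) predT)//=.
  - by congr esum; rewrite predeqE => -[a b]; split; move=> [i _ <-]; exists i.
  - by move=> k _; exact: box_vol_ge0.
  - by move=> ? ? _ _; exact: (@can_inj _ _ _ snd).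
apply: lee_nneseries => k _ *; last exact: (PG k).2.
by apply: nneseries_ge0 => m _ _; exact: box_vol_ge0.
Qed.

HB.instance Definition _ := isOuterMeasure.Build R E lebesgue_outer
  lebesgue_outer0 lebesgue_outer_ge0 le_lebesgue_outer
  lebesgue_outer_sigma_subadditive.

End LebesgueMeasure.

Definition lebesgue_outer_measure (R : realType) (n : nat) :
    {outer_measure set 'rV[R]_n.+1 -> \bar R} := @lebesgue_outer R n.

(* Lebesgue measure on the sigma-algebra of Lebesgue (i.e. Caratheodory)
   measurable subsets of R^(n+1). *)
Definition lebesgueE (R : realType) (n : nat) :
    {measure set (caratheodory_type (lebesgue_outer_measure R n)) -> \bar R} :=
  lebesgue_outer_measure R n.

Section Domains.
Context {R : realType} {n : nat}.
Local Notation E := 'rV[R]_n.+1.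
Implicit Types (Om : set E) (p : \bar R).

Definition ae_on Om (P : E -> Prop) : Prop :=
  \forall x \ae lebesgueE R n, Om x -> P x.

Definition Lp_on Om p (f : E -> R) : Prop := f \_ Om \in Lfun (lebesgueE R n) p.

(* The essential infimum over Om: f is extended by +oo outside Om. *)
Definition ess_inf_on Om (f : E -> R) : \bar R :=
  ess_inf (lebesgueE R n) (patch (cst +oo%E) Om (EFin \o f)).

Definition bdry Om : set E := closure Om `\` Om°.

Definition e_ (i : 'I_n.+1) : E := delta_mx 0 i.

(* g is the gradient of the C^{1,1} function gam on R^n.  The partial
   derivatives are Lipschitz, hence continuous. *)
Definition C11_fun (gam : 'rV[R]_n -> R) (g : 'I_n -> 'rV[R]_n -> R) : Prop :=
  (forall y j, is_derive y (delta_mx 0 j) gam (g j y)) /\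
  exists K : R, forall j y z, `|g j y - g j z| <= K * `|y - z|.

(* Near x0, Om is the strict epigraph (sgn = false) or strict hypograph
   (sgn = true) of x_k = +- gam (x'), with x' the coordinates other than x_k. *)
Definition graph_chart Om (x0 : E) (k : 'I_n.+1) (sgn : bool)
    (gam : 'rV[R]_n -> R) (g : 'I_n -> 'rV[R]_n -> R) : Prop :=
  C11_fun gam g /\
  exists2 r : R, 0 < r &
    forall x, ball x0 r x -> (Om x <-> gam (col' k x) < (-1) ^+ sgn * x 0 k).

Definition C11_boundary Om : Prop :=
  forall x0, bdry Om x0 -> exists k sgn gam g, graph_chart Om x0 k sgn gam g.

(* Gradient at x0 of the local defining function gam (x') - (-1)^sgn x_k, which
   is negative inside Om. *)
Definition chart_normal (x0 : E) (k : 'I_n.+1) (sgn : bool)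
    (g : 'I_n -> 'rV[R]_n -> R) : E :=
  \row_i if unlift k i is Some j then g j (col' k x0) else - (-1) ^+ sgn.

Definition outward_unit_normal Om (nu : E -> E) : Prop :=
  forall x0, bdry Om x0 -> exists k sgn gam g,
    graph_chart Om x0 k sgn gam g /\
    let N := chart_normal x0 k sgn g in
    nu x0 = (Num.sqrt (\sum_i N 0 i ^+ 2))^-1 *: N.

End Domains.

Section Sobolev.
Context {R : realType} {n : nat}.
Local Notation E := 'rV[R]_n.+1.

Fixpoint Ck (k : nat) (f : E -> R) : Prop :=
  continuous f /\
  if k is k'.+1 then
    forall i : 'I_n.+1, (forall x, derivable f x (e_ i)) /\ Ck k' ('D_(e_ i) f)
  else True.

Definition test_fun (Om : set E) (f : E -> R) : Prop :=
  (forall k, Ck k f) /\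
  exists K : set E, [/\ compact K, K `<=` Om & forall x, ~ K x -> f x = 0].

Definition weak_partial (Om : set E) (i : 'I_n.+1) (w g : E -> R) : Prop :=
  forall f, test_fun Om f ->
    \int[lebesgueE R n]_(x in Om) (w x * 'D_(e_ i) f x) =
    - \int[lebesgueE R n]_(x in Om) (g x * f x).

(* An element of W^{2,p}(Om), p greater than the dimension, together with its
   weak derivatives.  As usual in this range of p, it is identified with its
   C^1(closure Om) representative (Sobolev embedding), which gives a meaning to
   its values and its gradient at the points of Om and of the boundary; the
   values outside closure Om are irrelevant. *)
Record W2 (Om : set E) (p : R) := MkW2 {
  w_val :> E -> R ;
  w_grad : 'I_n.+1 -> E -> R ;
  w_hess : 'I_n.+1 -> 'I_n.+1 -> E -> R ;
  w_val_Lp : Lp_on Om p%:E w_val ;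
  w_grad_Lp : forall i, Lp_on Om p%:E (w_grad i) ;
  w_hess_Lp : forall i j, Lp_on Om p%:E (w_hess i j) ;
  w_grad_weak : forall i, weak_partial Om i w_val (w_grad i) ;
  w_hess_weak : forall i j, weak_partial Om i (w_grad j) (w_hess i j) ;
  w_val_cont : {within closure Om, continuous w_val} ;
  w_grad_cont : forall i, {within closure Om, continuous (w_grad i)} ;
  w_grad_classical :
    forall i x, Om x -> is_derive x (e_ i) w_val (w_grad i x)
}.

Definition normal_deriv (Om : set E) (p : R) (nu : E -> E) (w : W2 Om p)
    (x : E) : R := \sum_i w_grad w i x * nu x 0 i.

Record operator := MkOperator {
  op_a : 'I_n.+1 -> 'I_n.+1 -> E -> R ;
  op_b : 'I_n.+1 -> E -> R ;
  op_c : E -> R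
}.

Definition op_app (L : operator) (Om : set E) (p : R) (w : W2 Om p) (x : E) : R :=
  \sum_i \sum_j op_a L i j x * w_hess w i j x
  + \sum_i op_b L i x * w_grad w i x + op_c L x * w x.

Definition admissible (Om : set E) (c0 C0 T : R) (L : operator) : Prop :=
  [/\ forall i j, {within closure Om, continuous (op_a L i j)},
      forall i, Lp_on Om +oo%E (op_b L i),
      Lp_on Om +oo%E (op_c L),
      forall x (xi : E), Om x ->
        c0 * (\sum_i xi 0 i ^+ 2)
          <= \sum_i \sum_j op_a L i j x * xi 0 i * xi 0 j
          <= C0 * (\sum_i xi 0 i ^+ 2) &
      forall x, Om x -> (forall i, `|op_b L i x| <= T) /\ `|op_c L x| <= T].

Definition supersolution (L : operator) (Om : set E) (p : R) (w : W2 Om p) : Prop :=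
  ae_on Om (fun x => op_app L w x <= 0) /\ forall x, bdry Om x -> 0 <= w x.

Definition weak_max_principle (L : operator) (Om : set E) (p : R) : Prop :=
  forall w : W2 Om p, supersolution L w -> forall x, Om x -> 0 <= w x.

Definition strong_max_principle (L : operator) (Om : set E) (p : R)
    (nu : E -> E) : Prop :=
  forall w : W2 Om p, supersolution L w ->
    (forall x, Om x -> w x = 0) \/
    ((forall x, Om x -> 0 < w x) /\
     forall x0, bdry Om x0 -> w x0 = 0 -> normal_deriv nu w x0 < 0).

End Sobolev.
Arguments operator R n : clear implicits.

(* |w|^(gam - 1) w, read as the constant 1 when gam = 0. *)
Definition spow {R : realType} (gam w : R) : R :=
  if gam == 0 then 1 else `|w| `^ (gam - 1) * w.

Section System.
Context {R : realType} {n : nat}.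
Local Notation E := 'rV[R]_n.+1.
Variables (Om : set E) (p : R) (L1 L2 : operator R n) (a b : E -> R).
Variables (alpha1 alpha2 beta1 beta2 : R).

Definition strong_solution (la mu : R) (u v : W2 Om p) : Prop :=
  [/\ ae_on Om (fun x =>
        - op_app L1 u x = la * a x * spow alpha1 (u x) * spow beta1 (v x)),
      ae_on Om (fun x =>
        - op_app L2 v x = mu * b x * spow alpha2 (v x) * spow beta2 (u x)) &
      forall x, bdry Om x -> u x = 0 /\ v x = 0].

Definition nontrivial (u v : W2 Om p) : Prop :=
  exists2 x, Om x & u x != 0 \/ v x != 0.

Definition system_eigenvalue : set (R * R) :=
  [set lm | exists phi psi : W2 Om p,
     strong_solution lm.1 lm.2 phi psi /\ nontrivial phi psi].

Definition system_principal_eigenvalue : set (R * R) :=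
  [set lm | exists phi psi : W2 Om p,
     [/\ strong_solution lm.1 lm.2 phi psi, nontrivial phi psi &
         forall x, Om x -> 0 < phi x /\ 0 < psi x]].

End System.

Section Curves.
Context {R : realType}.
Variables (alpha1 alpha2 beta1 beta2 Lambda0 : R).

Definition curve_expr (lm : R * R) : R :=
  lm.1 `^ (Num.sqrt (beta1 * (1 - alpha1)))^-1 *
  lm.2 `^ (Num.sqrt (beta2 * (1 - alpha2)))^-1.

Definition level_curve : set (R * R) :=
  [set lm | [/\ 0 < lm.1, 0 < lm.2 & curve_expr lm = Lambda0]].

Definition region1 : set (R * R) :=
  [set lm | [/\ 0 < lm.1, 0 < lm.2 & curve_expr lm < Lambda0]].

Definition region2 : set (R * R) := [set lm | region1 (lm.1, - lm.2)].

Definition curve2 (C1 : set (R * R)) : set (R * R) :=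
  [set lm | C1 (lm.1, - lm.2)].

Definition opp_set (A : set (R * R)) : set (R * R) := [set - x | x in A].

End Curves.

(* Main.v *)
Require Import Defs.
From HB Require Import structures.
From mathcomp Require Import all_boot all_order all_algebra.
From mathcomp Require Import all_classical all_reals all_analysis.
From mathcomp Require Import ess_sup_inf measurable_realfun.
From mathcomp Require Import ring lra.

Import Order.TTheory GRing.Theory Num.Theory.
Import numFieldNormedType.Exports.

Local Open Scope classical_set_scope.
Local Open Scope ring_scope.

(** The strategy is a comparison with principal eigenfunctions.  Every point
[(la, mu)] of the four regions satisfies [|la| < la'] and [|mu| < mu'] for some
point [(la', mu')] of the principal curve ([below_curve_dominated]).  Let
[(phi, psi)] be positive eigenfunctions for [(la', mu')] and let [(u, v)] solve
the system with [(la, mu)].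

By Hopf's lemma [phi] and [psi] have a strictly negative normal derivative on the
boundary, so that [u] and [v], which vanish there, satisfy [|u| <= s * phi] and
[|v| <= t * psi] for some constants ([Hopf_domination]); take [s] and [t] least.
Since [|spow g w| = |w| ^ g], the right-hand side of the first equation is at
most [|la| / la' * s ^ alpha1 * t ^ beta1] times that of the equation of [phi], and
the weak maximum principle applied to [k * phi + u] and [k * phi - u] gives
[|u| <= k * phi] with [k] this factor ([equation_comparison]).  As [s] is least,
[s <= |la| / la' * s ^ alpha1 * t ^ beta1], and likewise
[t <= |mu| / mu' * t ^ alpha2 * s ^ beta2].  Both ratios are below 1, so
[beta1 * beta2 = (1 - alpha1) * (1 - alpha2)] forces [s = t = 0]
([coupled_powers_eq0]): the solution is trivial.  Only absolute values of [la],
[mu], [u] and [v] enter, which is why the four regions are treated at once.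

Two ingredients need work.  To apply the maximum principle to a combination of
elements of W^{2,p}, the weak derivatives have to be additive, hence the
products of L^p functions and derivatives of test functions integrable; this
rests on the measurability of open sets for the Lebesgue outer measure.  To
turn a negative normal derivative into [w >= 0] near a boundary point, one
follows the normal of the chart at that point until it leaves the domain: [w]
decreases along this segment and vanishes at its end. *)

(** * Lebesgue measurability of open sets *)

Definition set_coord {R : realType} {m : nat} (x : 'rV[R]_m) (i : 'I_m) (c : R) : 'rV[R]_m :=
  \row_j if j == i then c else x 0 j.

Lemma set_coordE {R : realType} {m : nat} (x : 'rV[R]_m) i c j :
  set_coord x i c 0 j = if j == i then c else x 0 j.
Proof. by rewrite mxE. Qed.

Lemma coord_le_norm {R : realType} {m : nat} (x : 'rV[R]_m) i : `|x 0 i| <= `|x|.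
Proof.
rewrite [leRHS]/Num.norm /= mx_normrE; apply/bigmax_geP; right => /=.
by exists (0, i).
Qed.

Section LebesgueMeasurability.
Context {R : realType} {n : nat}.
Local Notation E := 'rV[R]_n.+1.
Implicit Types (ab : E * E) (i : 'I_n.+1) (c d : R).

Definition half_space i c : set E := [set x | x 0 i < c].

Definition box_below i c ab : E * E :=
  (ab.1, set_coord ab.2 i (Num.min (ab.2 0 i) c)).

Definition box_above i c d ab : E * E :=
  (set_coord ab.1 i (Num.max (ab.1 0 i) (c - d)), ab.2).

Lemma box_belowP i c ab : box ab `&` half_space i c `<=` box (box_below i c ab).
Proof.
move=> x [abx xc] j /=; have /andP[h1 h2] := abx j.
by rewrite h1 set_coordE /=; case: eqP => [->|//]; rewrite lt_min xc (andP (abx i)).2.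
Qed.

Lemma box_aboveP i c d ab : 0 < d ->
  box ab `&` ~` half_space i c `<=` box (box_above i c d ab).
Proof.
move=> d0 x [abx /= /negP]; rewrite -leNgt => cx j /=.
have /andP[h1 h2] := abx j; rewrite h2 set_coordE andbT; case: eqP => [->|//].
rewrite gt_max (andP (abx i)).1 /=; lra.
Qed.

Definition face i ab : R := \prod_(j | j != i) Num.max 0 (ab.2 0 j - ab.1 0 j).

Lemma face_ge0 i ab : 0 <= face i ab.
Proof. by apply: prodr_ge0 => j _; rewrite le_max lexx. Qed.

(** Cutting a box by a hyperplane preserves the total volume; enlarging the upper
part by [d], so that it stays an open box containing the points of the
hyperplane, costs at most [d] times the area of the face. *)
Lemma box_vol_split i c d ab : 0 < d ->
  (box_vol (box_below i c ab) + box_vol (box_above i c d ab)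
   <= box_vol ab + (d * face i ab)%:E)%E.
Proof.
move=> d0; rewrite /box_vol -!EFinD lee_fin.
have facE ab' : (forall j, j != i -> ab'.2 0 j - ab'.1 0 j = ab.2 0 j - ab.1 0 j) ->
    \prod_j Num.max 0 (ab'.2 0 j - ab'.1 0 j) =
    Num.max 0 (ab'.2 0 i - ab'.1 0 i) * face i ab.
  move=> h; rewrite (bigD1 i)//=; congr (_ * _).
  by apply: eq_bigr => j ji; rewrite h.
rewrite (facE ab)// (facE (box_below i c ab)); last first.
  by move=> j ji; rewrite /= set_coordE (negbTE ji).
rewrite (facE (box_above i c d ab)); last first.
  by move=> j ji; rewrite /= set_coordE (negbTE ji).
rewrite -!mulrDl ler_wpM2r ?face_ge0//= !set_coordE eqxx.
rewrite !maxEle !minEle; repeat case: ifPn => //; lra.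
Qed.

(** Split every box of a cover by the hyperplane; the thickness [d k] of the
[k]-th overlap is chosen so that the excess volumes sum up to at most [e]. *)
Lemma half_space_measurable i c :
  (lebesgue_outer_measure R n).-cara.-measurable (half_space i c).
Proof.
apply: le_caratheodory_measurable => X.
apply: le_ereal_inf_tmp => _ [F XF <-].
apply/lee_addgt0Pr => e e0.
pose d k : R := e / (2 ^ k.+1)%:R / (face i (F k) + 1).
have d0 k : 0 < d k.
  by rewrite /d !divr_gt0// ?ltr0n ?expn_gt0// ltr_wpDl ?face_ge0.
apply: (le_trans _ (epsilon_trick _ _ _)); [|by move=> k; exact: box_vol_ge0|exact: ltW].
apply: (@le_trans _ _ (\sum_(k <oo) (box_vol (box_below i c (F k)) +
    box_vol (box_above i c (d k) (F k))))%E); last first.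
  apply: lee_nneseries => [k _ _|k _].
    by rewrite adde_ge0 ?box_vol_ge0.
  apply: (@le_trans _ _ (box_vol (F k) + (d k * face i (F k))%:E)%E).
    exact: box_vol_split.
  rewrite leeD2l// lee_fin /d -[leLHS]mulrA ler_piMr//.
    by rewrite divr_ge0 ?ltW// ltr0n expn_gt0.
  by rewrite mulrC ler_pdivrMr ?mul1r ?lerDl// ltr_wpDl ?face_ge0.
rewrite nneseriesD; [|by move=> *; exact: box_vol_ge0..].
apply: leeD; apply: ereal_inf_lbound.
- exists (fun k => box_below i c (F k)) => //= x [Xx xc].
  by have [k _ Fkx] := XF _ Xx; exists k => //; exact: box_belowP.
- exists (fun k => box_above i c (d k) (F k)) => //= x [Xx xc].
  by have [k _ Fkx] := XF _ Xx; exists k => //; exact: box_aboveP.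
Qed.

Definition half_open_box (q : {ffun 'I_n.+1 -> rat * rat}) : set E :=
  [set x | forall i, ratr (q i).1 <= x 0 i < ratr (q i).2].

Lemma half_open_box_measurable q :
  (lebesgue_outer_measure R n).-cara.-measurable (half_open_box q).
Proof.
have -> : half_open_box q = \bigcap_(i in [set: 'I_n.+1])
    (half_space i (ratr (q i).2) `&` ~` half_space i (ratr (q i).1)).
  apply/seteqP; split => x /= h i; have := h i.
    by move=> /andP[h1 h2] _; split => //; apply/negP; rewrite -leNgt.
  by move=> /(_ I)[h1 /negP]; rewrite -leNgt => ->.
apply: fin_bigcap_measurable; first exact: finite_finset.
move=> i _; apply: measurableI; first exact: half_space_measurable.
by apply: measurableC; exact: half_space_measurable.
Qed.

(** An open set is the union of the countably many half-open boxes with rational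
vertices that it contains; half-open boxes are finite intersections of half
spaces and of their complements. *)
Lemma open_lebesgue_measurable (U : set E) : open U ->
  (lebesgue_outer_measure R n).-cara.-measurable U.
Proof.
move=> oU.
have -> : U = \bigcup_q (if `[< half_open_box q `<=` U >]
                         then half_open_box q else set0).
  apply/seteqP; split => [x Ux|x [q _]]; last by case: asboolP => // h /h.
  have /nbhs_ballP[e /= e0 xeU] : nbhs x U by exact: open_nbhs_nbhs.
  have rat_between (a b : R) : a < b -> {q : rat | a < ratr q < b}.
    move=> ab; apply: cid; have [q] := rat_in_itvoo ab.
    by rewrite in_itv /= => ?; exists q.
  pose lo i := rat_between (x 0 i - e) (x 0 i) ltac:(lra).
  pose hi i := rat_between (x 0 i) (x 0 i + e) ltac:(lra).
  exists [ffun i => (sval (lo i), sval (hi i))] => //.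
  have -> : `[< half_open_box [ffun i => (sval (lo i), sval (hi i))] `<=` U >].
    apply/asboolP => y yq; apply: xeU; split=> // a i; rewrite (ord1 a).
    have := yq i; rewrite ffunE /=.
    have /andP[? ?] := svalP (lo i); have /andP[? ?] := svalP (hi i).
    move=> /andP[? ?]; rewrite /ball /= ltr_norml; lra.
  move=> i; rewrite ffunE /=.
  have /andP[? ?] := svalP (lo i); have /andP[? ?] := svalP (hi i); lra.
apply: countable_bigcupT_measurable; first exact: countableP.
by move=> q; case: ifP => _; [exact: half_open_box_measurable|exact: measurable0].
Qed.

Lemma continuous_lebesgue_measurable (f : E -> R) : continuous f ->
  measurable_fun setT (f : caratheodory_type (lebesgue_outer_measure R n) -> R).
Proof.
move=> cf; apply: (measurability _ (RGenOInfty.measurableE R)).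
move=> _ [_ [c ->] <-]; rewrite setTI.
apply: open_lebesgue_measurable.
by apply: open_comp; [move=> x _; exact: cf|rewrite set_itvE; exact: open_gt].
Qed.

Lemma bounded_lebesgue_fin (A : set E) : bounded_set A ->
  (lebesgueE R n A < +oo)%E.
Proof.
move=> [M0 [_ hM0]]; pose M := M0 + 1.
have hM x : A x -> `|x| <= M by apply: hM0; rewrite ltrDl.
pose F : nat -> E * E :=
  fun k => if k is 0 then (const_mx (- (M + 1)), const_mx (M + 1)) else (0, 0).
apply: (@le_lt_trans _ _ (\sum_(k <oo) box_vol (F k))%E).
  apply: ereal_inf_lbound; exists F => //= x Ax; exists 0%N => //= i.
  rewrite !mxE -ltr_norml.
  have : `|x 0 i| <= `|x| by exact: coord_le_norm.
  have := hM _ Ax; lra.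
rewrite (nneseries_split 0 1); last by move=> *; exact: box_vol_ge0.
rewrite eseries0 => [|[|k]//= _ _]; last exact: box_vol00.
by rewrite adde0 big_nat1 /= ltry.
Qed.

End LebesgueMeasurability.

(** * Linear combinations in W^{2,p} *)

Lemma bounded_closure {R : realType} {V : normedModType R} (A : set V) :
  bounded_set A -> bounded_set (closure A).
Proof.
move=> [M [Mr hM]]; exists M; split=> // M' MM' x Ax.
have cB : closed [set x : V | `|x| <= M'].
  apply: (@closed_comp _ _ (fun x : V => `|x|) [set y | y <= M']).
    by move=> ? _; exact: norm_continuous.
  exact: closed_le.
have /(_ x Ax) := closureS (hM _ MM').
by rewrite -(proj1 (closure_id _) cB).
Qed.

Section Sobolev_linear_combination.
Context {R : realType} {n : nat}.
Local Notation E := 'rV[R]_n.+1.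
Local Notation mu := (lebesgueE R n).
Variables (Om : set E) (p : R).
Hypotheses (oOm : open Om) (bOm : bounded_set Om) (p1 : 1 <= p).

Lemma Lp_on_linear (k : R) (f g : E -> R) :
  Lp_on Om p%:E f -> Lp_on Om p%:E g -> Lp_on Om p%:E (fun x => k * f x + g x).
Proof.
move=> lf lg; rewrite /Lp_on.
have -> : (fun x => k * f x + g x) \_ Om = k *: (f \_ Om) + g \_ Om.
  by apply/funext => x; rewrite !fctE /patch; case: ifP => // _; rewrite scaler0 addr0.
have p1' : (1 <= p%:E)%E by rewrite lee_fin.
exact: (Lfun_submod_closed mu p1').2.
Qed.

(** On the bounded set [Om] the continuous factor is bounded by some [M], and
[|w| <= 1 + |w| ^ p], which is integrable as [Om] has finite measure. *)
Lemma integrable_Lp_continuous (w f : E -> R) :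
  Lp_on Om p%:E w -> continuous f ->
  mu.-integrable Om (EFin \o (fun x => w x * f x)).
Proof.
move=> lw cf.
have mOm : measurable (Om : set (caratheodory_type (lebesgue_outer_measure R n))).
  exact: open_lebesgue_measurable.
have mw : measurable_fun (Om : set (caratheodory_type (lebesgue_outer_measure R n))) w.
  apply/(measurable_restrictT _ mOm).
  by move: lw; rewrite /Lp_on inE => /andP[/[!inE]].
have mf : measurable_fun (Om : set (caratheodory_type (lebesgue_outer_measure R n))) f.
  exact/measurable_funTS/continuous_lebesgue_measurable.
have [M M0 fM] : exists2 M, 0 <= M & forall x, Om x -> `|f x| <= M.
  have [M0 [_ hM]] : bounded_set (f @` closure Om).
    apply: compact_bounded; apply: continuous_compact.
      exact: continuous_subspaceT.
    apply: bounded_closed_compact; last exact: closed_closure.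
    exact: bounded_closure.
  exists (`|M0| + 1) => [|x Ox]; first by rewrite addr_ge0.
  apply: (hM (`|M0| + 1)); first by rewrite ltr_pwDr// ler_norm.
  by exists x => //; exact: subset_closure.
pose h (x : E) : R := M * (1 + `|(w \_ Om) x| `^ p).
apply: (@le_integrable _ _ _ mu _ mOm _ (EFin \o h)).
- by apply/measurable_EFinP; exact: measurable_funM.
- move=> x Ox; rewrite /= lee_fin /h normrM mulrC.
  rewrite [leRHS]ger0_norm; last by rewrite mulr_ge0// addr_ge0// powR_ge0.
  apply: ler_pM => //; first exact: fM.
  rewrite patchT ?inE//.
  have [w1|w1] := leP `|w x| 1.
    by rewrite (le_trans w1)// lerDl powR_ge0.
  rewrite -[leLHS](@powRr1 R)//.
  rewrite (@le_trans _ _ (`|w x| `^ p))//; last by rewrite lerDr.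
  by rewrite ler_powR// ltW.
- have -> : EFin \o h = (fun x => M%:E * ((cst 1 x)%:E + (`|(w \_ Om) x| `^ p)%:E))%E.
    by apply/funext => x.
  apply: integrableZl => //; apply: integrableD => //.
    apply/integrableP; split; first exact/measurable_EFinP.
    under eq_integral do rewrite /= normr1.
    by rewrite integral_cst// mul1e; exact: bounded_lebesgue_fin.
  apply: (integrableS measurableT) => //.
  exact: Lfun_integrable.
Qed.

Lemma weak_partial_linear (i : 'I_n.+1) (k : R) (f g f' g' : E -> R) :
  Lp_on Om p%:E f -> Lp_on Om p%:E g -> Lp_on Om p%:E f' -> Lp_on Om p%:E g' ->
  weak_partial Om i f f' -> weak_partial Om i g g' ->
  weak_partial Om i (fun x => k * f x + g x) (fun x => k * f' x + g' x).
Proof.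
move=> lf lg lf' lg' ff' gg' t tt.
have [ct] := tt.1 1%N => /(_ i)[_ [cdt _]].
have mOm : measurable (Om : set (caratheodory_type (lebesgue_outer_measure R n))).
  exact: open_lebesgue_measurable.
have split_int (u v s : E -> R) : Lp_on Om p%:E u -> Lp_on Om p%:E v -> continuous s ->
    \int[mu]_(x in Om) ((k * u x + v x) * s x) =
    k * \int[mu]_(x in Om) (u x * s x) + \int[mu]_(x in Om) (v x * s x).
  move=> lu lv cs.
  have iu := @integrable_Lp_continuous u s lu cs.
  have iv := @integrable_Lp_continuous v s lv cs.
  rewrite -RintegralZl// -RintegralD//; last first.
    have -> : EFin \o (fun x => k * (u x * s x)) =
      (fun x => k%:E * (EFin \o (fun x => u x * s x)%R) x)%E by apply/funext.
    exact: integrableZl.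
  by apply: eq_Rintegral => x _; rewrite mulrDl mulrA.
by rewrite !split_int// ff'// gg'// opprD mulrN.
Qed.

(** Stated with pointwise equations because the record bundles the proofs about
the weak derivatives: only the values of [w] and of its derivatives matter. *)
Lemma W2_linear (k : R) (u v : W2 Om p) : exists w : W2 Om p,
  [/\ forall x, w x = k * u x + v x,
      forall i x, w_grad w i x = k * w_grad u i x + w_grad v i x &
      forall i j x, w_hess w i j x = k * w_hess u i j x + w_hess v i j x].
Proof.
have lv := Lp_on_linear k _ _ (w_val_Lp u) (w_val_Lp v).
have lg i := Lp_on_linear k _ _ (w_grad_Lp u i) (w_grad_Lp v i).
have lh i j := Lp_on_linear k _ _ (w_hess_Lp u i j) (w_hess_Lp v i j).
have wg i := weak_partial_linear _ k _ _ _ _ (w_val_Lp u) (w_val_Lp v) (w_grad_Lp u i)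
  (w_grad_Lp v i) (w_grad_weak u i) (w_grad_weak v i).
have wh i j := weak_partial_linear _ k _ _ _ _ (w_grad_Lp u j) (w_grad_Lp v j)
  (w_hess_Lp u i j) (w_hess_Lp v i j) (w_hess_weak u i j) (w_hess_weak v i j).
have cont_lin (f g : E -> R) : {within closure Om, continuous f} ->
    {within closure Om, continuous g} ->
    {within closure Om, continuous (fun x => k * f x + g x)}.
  by move=> cf cg x; apply: cvgD; [apply: cvgM; [exact: cvg_cst|exact: cf]|exact: cg].
have gc i x : Om x -> is_derive x (e_ i) (fun x => k * u x + v x)
    (k * w_grad u i x + w_grad v i x).
  move=> Ox; have := w_grad_classical u i Ox; have := w_grad_classical v i Ox.
  by move=> dv du; apply: is_deriveD; exact: is_deriveZ.
by exists (MkW2 lv lg lh wg wh (cont_lin _ _ (@w_val_cont _ _ _ _ u) (@w_val_cont _ _ _ _ v))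
  (fun i => cont_lin _ _ (@w_grad_cont _ _ _ _ u i) (@w_grad_cont _ _ _ _ v i)) gc).
Qed.

End Sobolev_linear_combination.

(** * Functions with continuous partial derivatives *)

Section PartialDerivatives.
Context {R : realType} {m : nat}.
Local Notation V := 'rV[R]_m.
Implicit Types (f : V -> R) (x y z v : V).

Lemma is_derive_along_line f y v (t d : R) :
  is_derive (y + t *: v) v f d -> is_derive t 1 (fun s => f (y + s *: v)) d.
Proof.
move=> [df fd].
have E : (fun h : R => h^-1 *: ((f \o shift (y + t *: v)) (h *: v) - f (y + t *: v))) =
  (fun h : R => h^-1 *: (((fun s => f (y + s *: v)) \o shift t) (h *: 1) - f (y + t *: v))).
  apply/funext => h; congr (_ *: (f _ - _)).
  by rewrite /= [h *: 1]mulr1 scalerDl addrCA.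
by split; [rewrite /derivable -E; exact: df|rewrite /derive -E; exact: fd].
Qed.

Lemma MVT_unordered (g dg : R -> R) (a b : R) :
  (forall s : R, Num.min a b <= s <= Num.max a b -> is_derive s 1 g (dg s)) ->
  exists2 c, Num.min a b <= c <= Num.max a b & g b - g a = dg c * (b - a).
Proof.
wlog ab : a b / a <= b.
  move=> H; case/orP: (le_total a b) => [/H|ba]; first exact.
  rewrite minC maxC => dgab; have [c ci gc] := H _ _ ba dgab.
  by exists c => //; rewrite -opprB gc -mulrN opprB.
rewrite min_l// max_r// => dgab.
have [s|s|c cab gc] := @MVT_segment R g dg a b ab.
- by rewrite in_itv /= => /andP[ax xb]; apply: dgab; rewrite !ltW.
- apply: derivable_within_continuous => x xab.
  by have [] := dgab x xab.
- by exists c.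
Qed.

(** The vertices of a broken line from [y] to [z] with edges parallel to the
axes; it stays in any ball (a cube) that contains [y] and [z]. *)
Definition coord_path y z (k : nat) : V := \row_j if (j < k)%N then z 0 j else y 0 j.

Lemma coord_pathS y z (j : 'I_m) :
  coord_path y z j.+1 = coord_path y z j + (z 0 j - y 0 j) *: delta_mx 0 j.
Proof.
apply/rowP => i; rewrite !mxE eqxx /= ltnS leq_eqVlt (inj_eq val_inj).
case: eqVneq => [->|ij]; first by rewrite ltnn mulr1 addrC subrK.
by rewrite mulr0 addr0.
Qed.

Lemma ball_rowP (x y : V) (r : R) : 0 < r ->
  ball x r y <-> forall j, `|x 0 j - y 0 j| < r.
Proof.
move=> r0; split=> [[_ h] j|h]; first exact: h.
by split=> // i j; rewrite (ord1 i); exact: h.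
Qed.

(** Apply the mean value theorem on each edge of the coordinate path. *)
Lemma increment_partial f (d : 'I_m -> V -> R) (D : 'I_m -> R) x (r eps : R) :
  (forall y j, ball x r y -> is_derive y (delta_mx 0 j) f (d j y)) ->
  (forall y j, ball x r y -> `|d j y - D j| <= eps) ->
  forall y z, ball x r y -> ball x r z ->
  `|f z - f y - \sum_j D j * (z 0 j - y 0 j)| <= eps * \sum_j `|z 0 j - y 0 j|.
Proof.
move=> fd dD y z yb zb.
have r0 : 0 < r by case: yb.
have -> : f z - f y =
    \sum_(j < m) (f (coord_path y z j.+1) - f (coord_path y z j)).
  rewrite -(big_mkord xpredT (fun j => f (coord_path y z j.+1) - f (coord_path y z j))).
  rewrite telescope_sumr//; congr (f _ - f _); apply/rowP => j; rewrite !mxE//.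
  by rewrite ltn_ord.
rewrite -sumrB mulr_sumr; apply: le_trans (ler_norm_sum _ _ _) _.
apply: ler_sum => j _; rewrite coord_pathS.
set q := coord_path y z j.
have qb s : Num.min 0 (z 0 j - y 0 j) <= s <= Num.max 0 (z 0 j - y 0 j) ->
    ball x r (q + s *: delta_mx 0 j).
  move=> sb; apply/ball_rowP => // i.
  move/(ball_rowP _ _ _ r0) : yb => /(_ i); move/(ball_rowP _ _ _ r0) : zb => /(_ i).
  rewrite !mxE eqxx /=; case: eqVneq => [->|_]; last first.
    by rewrite mulr0 addr0; case: ifP.
  rewrite ltnn mulr1; move: sb; rewrite minEle maxEle !ltr_norml.
  by case: ifP => _ /andP[? ?] /andP[? ?] /andP[? ?]; lra.
have [|c cb] := @MVT_unordered (fun s => f (q + s *: delta_mx 0 j))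
    (fun s => d j (q + s *: delta_mx 0 j)) 0 (z 0 j - y 0 j).
  by move=> s sb; apply: is_derive_along_line; exact/fd/qb.
rewrite scale0r addr0 subr0 => ->.
by rewrite -mulrBl normrM ler_wpM2r// dD//; exact: qb.
Qed.

Lemma is_derive_continuous_partial f (d : 'I_m -> V -> R) x v :
  (\forall y \near x, forall j, is_derive y (delta_mx 0 j) f (d j y)) ->
  (forall j, {for x, continuous (d j)}) ->
  is_derive x v f (\sum_j d j x * v 0 j).
Proof.
move=> fd dc.
suff lim_f : (fun h : R => h^-1 *: ((f \o shift x) (h *: v) - f x)) @ 0^' -->
    \sum_j d j x * v 0 j.
  apply: DeriveDef; first by apply: cvgP; exact: lim_f.
  by apply: cvg_lim => //; exact: lim_f.
apply/cvgrPdist_le => e e0.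
pose S := \sum_j `|v 0 j| + 1.
have S0 : 0 < S by rewrite ltr_wpDl// sumr_ge0.
have eS : 0 < e / S by rewrite divr_gt0.
have dn : \forall y \near x, forall j, `|d j y - d j x| <= e / S.
  apply: (@filter_forall _ _ (fun j y => `|d j y - d j x| <= e / S) (nbhs x) _ _) => j.
  by have /cvgrPdist_le/(_ _ eS) := dc j; apply: filterS => y; rewrite distrC.
have /nbhs_ballP[r /= r0 xr] : nbhs x [set y |
    (forall j, is_derive y (delta_mx 0 j) f (d j y)) /\
    forall j, `|d j y - d j x| <= e / S].
  exact: (filterI fd dn).
have near_v : \forall h \near (0 : R), ball x r (h *: v + x).
  have : (fun h : R => h *: v + x) @ 0 --> (0 : R) *: v + x.
    by apply: cvgD; [apply: cvgZr_tmp; exact: cvg_id|exact: cvg_cst].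
  rewrite scale0r add0r => /cvg_ball; exact.
near=> h.
have h0 : h != 0 by near: h; exact: nbhs_dnbhs_neq.
have hb : ball x r (h *: v + x) by near: h; apply: nbhs_dnbhs; exact: near_v.
have := @increment_partial f d (d ^~ x) x r (e / S)
  (fun y j b => (xr y b).1 j) (fun y j b => (xr y b).2 j) x (h *: v + x)
  (ballxx _ r0) hb.
have -> : \sum_j d j x * ((h *: v + x) 0 j - x 0 j) = h * \sum_j d j x * v 0 j.
  by rewrite mulr_sumr; apply: eq_bigr => j _; rewrite !mxE addrK mulrCA.
have -> : \sum_j `|(h *: v + x) 0 j - x 0 j| = `|h| * \sum_j `|v 0 j|.
  by rewrite mulr_sumr; apply: eq_bigr => j _; rewrite !mxE addrK normrM.
move=> H; rewrite -(@ler_pM2l _ `|h|) ?normr_gt0//.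
rewrite -normrM mulrBr [h * (_ *: _)]mulVKf//= distrC.
apply: (le_trans H); rewrite mulrCA ler_wpM2l//.
by rewrite mulrAC ler_pdivrMr// ler_wpM2l ?(ltW e0)// lerDl.
Unshelve. all: by end_near. Qed.

End PartialDerivatives.

(** * Leaving the domain along the normal *)

Section Chart.
Context {R : realType} {n : nat}.
Local Notation E := 'rV[R]_n.+1.
Variables (Om : set E).

(** The local defining function of a chart, negative in [Om]; [chart_normal] is
its gradient at the centre of the chart. *)
Definition graph_height (k : 'I_n.+1) (sgn : bool) (gam : 'rV[R]_n -> R) (x : E) : R :=
  gam (col' k x) - (-1) ^+ sgn * x 0 k.

(** The derivative of the height along [N] is [1 + sum_j g_j g0_j] with [g0] the
gradient of [gam] at the centre, and the sum is close to [sum_j g0_j ^ 2 >= 0]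
near the centre; hence a rate of growth of at least [1/2]. *)
Lemma graph_height_local (x0 : E) k sgn gam g :
  graph_chart Om x0 k sgn gam g ->
  let N := chart_normal x0 k sgn g in let h := graph_height k sgn gam in
  exists C r : R, [/\ 0 < r, 0 <= C,
    forall x, ball x0 r x -> (Om x <-> h x < 0),
    forall x y, ball x0 r x -> ball x0 r y -> `|h x - h y| <= C * `|x - y| &
    forall x t, 0 <= t -> ball x0 r x -> ball x0 r (x + t *: N) ->
      h x + t / 2 <= h (x + t *: N)].
Proof.
move=> [[dgam [K gK]] [r0 r00 Omr]] N h.
pose g0 j := g j (col' k x0).
pose G := \sum_j `|g0 j| + 1.
have G1 : 1 <= G by rewrite lerDr sumr_ge0.
have G0 : 0 < G by lra.
(* With this [eps] the oscillation of the gradient changes the growth rate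
   along [N] by at most [eps * G = 1/2]. *)
pose eps := (2 * G)^-1.
have eps0 : 0 < eps by rewrite invr_gt0; lra.
pose K' := `|K| + 1.
have K'0 : 0 < K' by rewrite ltr_wpDl.
pose r := Num.min r0 (eps / K').
have r_gt0 : 0 < r by rewrite lt_min r00 divr_gt0.
have ball_col x : ball x0 r x -> ball (col' k x0) r (col' k x).
  move=> /(ball_rowP _ _ _ r_gt0) bx; apply/ball_rowP => // j.
  by rewrite !mxE; exact: bx.
have gamE y z : ball (col' k x0) r y -> ball (col' k x0) r z ->
    `|gam z - gam y - \sum_j g0 j * (z 0 j - y 0 j)| <= eps * \sum_j `|z 0 j - y 0 j|.
  apply: (@increment_partial _ _ gam g g0) => u j ub.
  apply: le_trans (gK _ _ _) _.
  have : `|u - col' k x0| <= eps / K'.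
    move: ub; rewrite -ball_normE /ball_ /= distrC => /ltW/le_trans; apply.
    by rewrite ge_min lexx orbT.
  move=> H; apply: (@le_trans _ _ (K' * (eps / K'))).
    apply: (@le_trans _ _ (K' * `|u - col' k x0|)); last by rewrite ler_wpM2l// ltW.
    by rewrite ler_wpM2r// (le_trans (ler_norm _))// lerDl.
  by rewrite mulrC divfK// gt_eqF.
have normsgn : `|(-1) ^+ sgn : R| = 1 by rewrite normrX normrN1 expr1n.
have sgn2 : (-1) ^+ sgn * (-1) ^+ sgn = 1 :> R.
  by rewrite -expr2 -exprM mulnC exprM sqrrN !expr1n.
exists (G + eps * n%:R + 1), r; split => //.
- have : 0 <= eps * n%:R by rewrite mulr_ge0// ltW.
  lra.
- move=> x xb; rewrite /h /graph_height subr_lt0; apply: Omr.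
  by apply: le_ball xb; rewrite ge_min lexx.
- move=> x y xb yb.
  have H := gamE _ _ (ball_col _ yb) (ball_col _ xb).
  have colxy j : `|(col' k x) 0 j - (col' k y) 0 j| <= `|x - y|.
    by rewrite !mxE; have := coord_le_norm (x - y) (lift k j); rewrite !mxE.
  have kxy : `|x 0 k - y 0 k| <= `|x - y|.
    by have := coord_le_norm (x - y) k; rewrite !mxE.
  have sum_le : \sum_j `|(col' k x) 0 j - (col' k y) 0 j| <= n%:R * `|x - y|.
    apply: (@le_trans _ _ (\sum_(j < n) `|x - y|)); first exact: ler_sum.
    by rewrite sumr_const card_ord mulr_natl.
  have lin_le : `|\sum_j g0 j * ((col' k x) 0 j - (col' k y) 0 j)| <= G * `|x - y|.
    apply: (le_trans (ler_norm_sum _ _ _)).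
    apply: (@le_trans _ _ (\sum_j `|g0 j| * `|x - y|)).
      by apply: ler_sum => j _; rewrite normrM ler_wpM2l.
    by rewrite -mulr_suml ler_wpM2r// lerDl.
  have -> : h x - h y = (gam (col' k x) - gam (col' k y)
       - \sum_j g0 j * ((col' k x) 0 j - (col' k y) 0 j))
     + \sum_j g0 j * ((col' k x) 0 j - (col' k y) 0 j)
     - (-1) ^+ sgn * (x 0 k - y 0 k).
    by rewrite /h /graph_height; ring.
  rewrite (le_trans (ler_normB _ _))// mulrDl mul1r lerD//; last first.
    by rewrite normrM normsgn mul1r.
  rewrite (le_trans (ler_normD _ _))// mulrDl addrC lerD//.
  by rewrite (le_trans H)// -mulrA ler_wpM2l// ltW.
- move=> x t t0 xb xtb.
  have := gamE _ _ (ball_col _ xb) (ball_col _ xtb).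
  have dcol j : (col' k (x + t *: N)) 0 j - (col' k x) 0 j = t * g0 j.
    by rewrite !mxE liftK addrAC subrr add0r.
  under eq_bigr do rewrite dcol.
  under [X in _ <= _ * X -> _]eq_bigr do rewrite dcol normrM (ger0_norm t0).
  rewrite -mulr_sumr ler_norml => /andP[lo _].
  have epsG : eps * (t * \sum_j `|g0 j|) <= t / 2.
    have -> : t / 2 = eps * (t * G) by rewrite /eps; field; rewrite gt_eqF.
    by rewrite ler_wpM2l ?(ltW eps0)// ler_wpM2l// lerDl.
  have sq : 0 <= \sum_j g0 j * (t * g0 j).
    by apply: sumr_ge0 => j _; rewrite mulrCA mulr_ge0// -expr2 sqr_ge0.
  rewrite /h /graph_height.
  have -> : (x + t *: N) 0 k = x 0 k - t * (-1) ^+ sgn.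
    by rewrite !mxE unlift_none mulrN.
  have -> : (-1) ^+ sgn * (x 0 k - t * (-1) ^+ sgn) = (-1) ^+ sgn * x 0 k - t :> R.
    by rewrite mulrBr mulrCA sgn2 mulr1.
  lra.
Qed.

(** From a point of [Om] close to [x0] the height is slightly negative and grows
at rate at least [1/2] along [N], so the half-line leaves [Om] before it leaves
the ball of radius [rho].  The exit time is the infimum of the times spent
outside [Om]. *)
Lemma exit_along_normal (x0 : E) k sgn gam g (rho : R) : open Om ->
  graph_chart Om x0 k sgn gam g -> ~ Om x0 -> 0 < rho ->
  let N := chart_normal x0 k sgn g in
  exists2 d : R, 0 < d & forall x, Om x -> ball x0 d x ->
    exists T : R, [/\ 0 < T, bdry Om (x + T *: N) &
      forall t, 0 <= t < T -> Om (x + t *: N) /\ ball x0 rho (x + t *: N)].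
Proof.
move=> oOm ch Nx0 rho0 N.
have [C [r1 [r10 C0 Omh hC hN]]] := graph_height_local _ _ _ _ _ ch.
pose r := Num.min r1 rho.
have r0 : 0 < r by rewrite lt_min r10.
have br1 x : ball x0 r x -> ball x0 r1 x by apply: le_ball; rewrite ge_min lexx.
(* The half-line stays in the ball up to time [tau] and is outside [Om] then. *)
pose tau := r / (2 * (`|N| + 1)).
have N1 : 0 < `|N| + 1 by rewrite ltr_wpDl.
have tau0 : 0 < tau by rewrite divr_gt0// mulr_gt0.
have tauN : tau * `|N| <= r / 2.
  have -> : r / 2 = tau * (`|N| + 1) by rewrite /tau; field; rewrite gt_eqF.
  by rewrite ler_wpM2l ?(ltW tau0)// lerDl.
pose d := Num.min (r / 2) (tau / (2 * (C + 1))).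
have C1 : 0 < C + 1 by lra.
have d0 : 0 < d by rewrite lt_min !divr_gt0// mulr_gt0.
exists d => // x Ox xd.
have xr t : 0 <= t <= tau -> ball x0 r (x + t *: N).
  move=> /andP[t0 tt]; rewrite -ball_normE /ball_ /= opprD addrA.
  apply: (le_lt_trans (ler_normB _ _)).
  rewrite normrZ (ger0_norm t0).
  have : t * `|N| <= tau * `|N| by rewrite ler_wpM2r.
  move: xd; rewrite -ball_normE /ball_ /= lt_min => /andP[+ _]; lra.
have xr0 : ball x0 r x by have := xr 0; rewrite scale0r addr0; apply; rewrite lexx ltW.
have out_tau : ~ Om (x + tau *: N).
  have taub : ball x0 r (x + tau *: N) by apply: xr; rewrite lexx ltW.
  move=> /(Omh _ (br1 _ taub)); apply/negP; rewrite -leNgt.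
  have H1 := hN _ _ (ltW tau0) (br1 _ xr0) (br1 _ taub).
  have h0 : 0 <= graph_height k sgn gam x0.
    by rewrite leNgt; apply/negP => /(Omh _ (ballxx _ r10)).
  have := hC _ _ (ballxx _ r10) (br1 _ xr0).
  have xd' : `|x0 - x| <= tau / (2 * (C + 1)).
    by move: xd; rewrite -ball_normE /ball_ /= lt_min => /andP[_ /ltW].
  have Cd : C * `|x0 - x| <= tau / 2.
    apply: (@le_trans _ _ ((C + 1) * (tau / (2 * (C + 1))))).
      by apply: ler_pM => //; lra.
    by rewrite le_eqVlt; apply/orP; left; apply/eqP; field; rewrite gt_eqF.
  by rewrite ler_norml => /andP[_]; lra.
pose S := [set t : R | 0 <= t /\ ~ Om (x + t *: N)].
have S_tau : S tau by split; [exact: ltW|].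
have infS : has_inf S by split; [exists tau|exists 0 => s []].
pose T := inf S.
have T_tau : T <= tau by apply: ge_inf => //; case: infS.
have T0 : 0 <= T by apply: lb_le_inf; [exists tau|move=> s []].
have line_cont : continuous (fun t : R => x + t *: N).
  by move=> t; apply: cvgD; [exact: cvg_cst|apply: cvgZr_tmp; exact: cvg_id].
have belowT t : 0 <= t < T -> Om (x + t *: N).
  move=> /andP[t0 tT]; apply: contrapT => Nt; move: tT; apply/negP; rewrite -leNgt.
  by apply: ge_inf; [case: infS|split].
have NT : ~ Om (x + T *: N).
  move=> OT.
  have : nbhs T [set t | Om (x + t *: N)].
    by apply: line_cont; exact: open_nbhs_nbhs.
  move=> /nbhs_ballP[e /= e0 eT].
  have [s [s0 Ns] sT] := inf_adherent e0 infS.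
  have Ts : T <= s by apply: ge_inf; [case: infS|split].
  apply: Ns; apply: eT; rewrite /ball /= ltr_norml.
  by move: sT; rewrite -/T; lra.
have Tgt0 : 0 < T.
  rewrite lt_neqAle T0 andbT; apply/eqP => T00.
  by apply: NT; rewrite -T00 scale0r addr0.
exists T; split=> //.
- split; last by move=> /interior_subset.
  move=> B /line_cont /nbhs_ballP[e /= e0 eB].
  pose t := Num.max (T / 2) (T - e / 2).
  have tb : 0 <= t < T.
    by apply/andP; split; [rewrite le_max; apply/orP; left|rewrite gt_max; apply/andP; split]; lra.
  exists (x + t *: N); split; first exact: belowT.
  apply: eB; rewrite /ball /= ltr_norml.
  have : T - e / 2 <= t by rewrite le_max lexx orbT.
  move: tb => /andP[]; lra.
- move=> t tT; split; first exact: belowT.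
  apply: (@le_ball _ _ _ r); first by rewrite ge_min lexx orbT.
  by apply: xr; move: tT => /andP[]; lra.
Qed.

End Chart.

(** * Domination by a function with negative normal derivative *)

Section Hopf.
Context {R : realType} {n : nat}.
Local Notation E := 'rV[R]_n.+1.
Variables (Om : set E) (p : R) (nu : E -> E).
Hypotheses (oOm : open Om) (bOm : bounded_set Om) (p1 : 1 <= p).
Hypothesis hnu : outward_unit_normal Om nu.

Lemma within_closure_near (f : E -> R) x : {within closure Om, continuous f} ->
  closure Om x -> f y @[y --> within (closure Om) (nbhs x)] --> f x.
Proof. by move=> /subspace_continuousP; exact. Qed.

Lemma within_closure_inside (f : E -> R) x : {within closure Om, continuous f} ->
  Om x -> {for x, continuous f}.
Proof.
move=> cf Ox.
have /(continuous_subspaceW (@subset_closure _ Om)) := cf.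
by rewrite (continuous_open_subspace _ oOm) => /(_ x); apply; rewrite inE.
Qed.

Lemma W2_is_derive (w : W2 Om p) x v : Om x ->
  is_derive x v w (\sum_i w_grad w i x * v 0 i).
Proof.
move=> Ox; apply: (is_derive_continuous_partial w (w_grad w)).
  have : nbhs x Om by exact: open_nbhs_nbhs.
  by apply: filterS => y Oy j; exact: w_grad_classical.
by move=> j; apply: within_closure_inside => //; exact: w_grad_cont.
Qed.

(** The normal derivative is a positive multiple of the derivative [D] along the
normal [N] of a chart.  [D] is negative near [x0], so [w] is nonincreasing on
the segment from [x] to the boundary point where the half-line of direction
[N] leaves [Om], and [w] vanishes there. *)
Lemma Hopf_nonneg_near (w : W2 Om p) x0 : bdry Om x0 ->
  (forall x, bdry Om x -> w x = 0) -> normal_deriv nu w x0 < 0 ->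
  \forall x \near x0, Om x -> 0 <= w x.
Proof.
move=> bx0 w0 dw.
have [k [s [gam [g [ch nuE]]]]] := hnu _ bx0.
set N := chart_normal x0 k s g in nuE.
pose D x := \sum_i w_grad w i x * N 0 i.
have D0 : D x0 < 0.
  move: dw; rewrite /normal_deriv nuE.
  under eq_bigr do rewrite mxE mulrCA.
  rewrite -mulr_sumr; apply: contraTT; rewrite -!leNgt => DN.
  by rewrite mulr_ge0// invr_ge0 sqrtr_ge0.
have cD : {within closure Om, continuous D}.
  have -> : D = \sum_i (fun x => w_grad w i x * N 0 i).
    by apply/funext => x; rewrite fct_sumE.
  apply: (@big_ind _ (fun f : E -> R => {within closure Om, continuous f})).
  - by move=> x; exact: cvg_cst.
  - by move=> f1 f2 c1 c2 x; apply: cvgD; [exact: c1|exact: c2].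
  - by move=> i _ x; apply: cvgM; [exact: w_grad_cont|exact: cvg_cst].
have [cx0 Nx0] : closure Om x0 /\ ~ Om x0.
  by move: bx0; rewrite /bdry (interior_id _).1.
have /nbhs_ballP[rho /= rho0 rhoD] : nbhs x0 [set y | closure Om y -> D y < 0].
  have /cvgr_lt := within_closure_near _ _ cD cx0.
  by move=> /(_ _ D0).
have [d d0 hd] := exit_along_normal _ _ _ _ _ _ _ oOm ch Nx0 rho0.
apply/nbhs_ballP; exists d => //= x xd Ox.
have [T [T0 bT inT]] := hd x Ox xd.
rewrite -(w0 _ bT).
pose f t := w (x + t *: N).
have -> : w x = f 0 by rewrite /f scale0r addr0.
have df t : t \in `]0, T[ -> is_derive t (1 : R) f (D (x + t *: N)).
  rewrite in_itv /= => /andP[t0 tT]; apply: (@is_derive_along_line _ _ w x N t).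
  apply: W2_is_derive; apply: (inT t _).1; rewrite ltW//.
have cf : {within `[0, T], continuous f}.
  apply/subspace_continuousP => t; rewrite /= in_itv /= => /andP[t0 tT].
  have inC u : 0 <= u <= T -> closure Om (x + u *: N).
    move=> /andP[u0]; rewrite le_eqVlt => /predU1P[->|uT]; first exact: bT.1.
    by apply: subset_closure; apply: (inT u _).1; rewrite u0.
  have wc := within_closure_near _ _ (@w_val_cont _ _ _ _ w) (inC t _).
  apply: cvg_trans (wc _); last by rewrite t0.
  move=> B hB.
  have lc : {for t, continuous (fun u : R => x + u *: N)}.
    by apply: cvgD; [exact: cvg_cst|apply: cvgZr_tmp; exact: cvg_id].
  have lB : nbhs t [set u : R | closure Om (x + u *: N) -> B (w (x + u *: N))].
    exact: lc _ hB.
  apply: filterS lB => u /= h; rewrite in_itv /= => uT.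
  exact/h/inC.
have f_noninc : {in `[0, T] &, {homo f : a b /~ a <= b}}.
  apply: ler0_derive1_le_cc => //.
  - by move=> t /df [].
  - move=> t tT; have [_] := df t tT; rewrite derive1E => ->.
    move: tT; rewrite in_itv /= => /andP[t0 tT].
    have [Ot bt] := inT t ltac:(by rewrite ltW).
    by apply/ltW/rhoD => //; exact: subset_closure.
by apply: f_noninc; rewrite ?in_itv /= ?lexx ?ltW.
Qed.

Lemma normal_deriv_linear (k : R) (u v w : W2 Om p) x :
  (forall i x, w_grad w i x = k * w_grad u i x + w_grad v i x) ->
  normal_deriv nu w x = k * normal_deriv nu u x + normal_deriv nu v x.
Proof.
move=> h; rewrite /normal_deriv mulr_sumr -big_split /=.
by apply: eq_bigr => i _; rewrite h mulrDl mulrA.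
Qed.

Lemma W2_opp (u : W2 Om p) : exists v : W2 Om p,
  [/\ forall x, v x = - u x,
      forall i x, w_grad v i x = - w_grad u i x &
      forall i j x, w_hess v i j x = - w_hess u i j x].
Proof.
(* [- u] is obtained as [-2 * u + u]. *)
have [v [h1 h2 h3]] := W2_linear Om p oOm bOm p1 (-2) u u.
by exists v; split=> *; rewrite ?h1 ?h2 ?h3; ring.
Qed.

(** By compactness of the closure and monotonicity in [C], it is enough to find
[C] near each point.  Inside [Om], [phi] is bounded below by a positive
constant; at a boundary point, a large [C] makes the normal derivative of
[C * phi + u] negative. *)
Lemma Hopf_lower_bound (phi u : W2 Om p) :
  (forall x, Om x -> 0 < phi x) ->
  (forall x, bdry Om x -> phi x = 0 /\ normal_deriv nu phi x < 0) ->
  (forall x, bdry Om x -> u x = 0) ->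
  exists C : R, forall x, Om x -> - u x <= C * phi x.
Proof.
move=> phi0 phib ub.
have cK : compact (closure Om).
  apply: bounded_closed_compact; last exact: closed_closure.
  exact: bounded_closure.
have : \forall C \near +oo, closure Om `<=` [set x | Om x -> - u x <= C * phi x].
  apply: (compact_near_coveringP _).1 => // x0 cx0.
  suff [C0 HC0] : exists C0 : R, \forall x \near x0, Om x -> - u x <= C0 * phi x.
    exists ([set x | Om x -> - u x <= C0 * phi x], [set C | C0 < C]).
      by split; [exact: HC0|exact: (nbhs_pinfty_gt (num_real C0))].
    move=> [x C] [/= hx CC Ox]; apply: (le_trans (hx Ox)).
    by rewrite ler_wpM2r// ltW// phi0.
  have [Ox0|NOx0] := pselect (Om x0).
    have cphi := within_closure_inside _ _ (@w_val_cont _ _ _ _ phi) Ox0.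
    have cu := within_closure_inside _ _ (@w_val_cont _ _ _ _ u) Ox0.
    have hphi : phi x0 / 2 < phi x0 by have := phi0 _ Ox0; lra.
    have hu : u x0 - 1 < u x0 by lra.
    exists ((`|u x0| + 1) / (phi x0 / 2)).
    have nphi : nbhs x0 [set x | phi x0 / 2 < phi x] by exact: (cvgr_gt _ cphi _ hphi).
    have nu' : nbhs x0 [set x | u x0 - 1 < u x] by exact: (cvgr_gt _ cu _ hu).
    apply: filterS2 nphi nu' => x /= px ux Ox.
    apply: (@le_trans _ _ (`|u x0| + 1)); last first.
      have p2 : 0 < phi x0 / 2 by have := phi0 _ Ox0; lra.
      rewrite mulrAC ler_pdivlMr//; apply: ler_wpM2l; last exact: ltW.
      by rewrite addr_ge0.
    have : - u x0 <= `|u x0| by rewrite -normrN ler_norm.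
    lra.
  have bx0 : bdry Om x0 by rewrite /bdry (interior_id _).1.
  have [_ dphi] := phib _ bx0.
  pose C0 := (`|normal_deriv nu u x0| + 1) / - normal_deriv nu phi x0.
  have [w [w1 w2 _]] := W2_linear Om p oOm bOm p1 C0 phi u.
  exists C0.
  have : \forall x \near x0, Om x -> 0 <= w x.
    apply: Hopf_nonneg_near => // [x bx|].
      by rewrite w1 ub// (phib _ bx).1 mulr0 addr0.
    rewrite (normal_deriv_linear _ _ _ _ _ w2) /C0 invrN mulrN mulNr divfK; last first.
      by rewrite lt_eqF.
    have := ler_norm (normal_deriv nu u x0); lra.
  by apply: filterS => x h /h; rewrite w1; lra.
move=> [M [_ hM]]; exists (M + 1) => x Ox.
by apply: (hM (M + 1)) => //; [rewrite ltrDl|exact: subset_closure].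
Qed.

Lemma Hopf_domination (phi u : W2 Om p) :
  (forall x, Om x -> 0 < phi x) ->
  (forall x, bdry Om x -> phi x = 0 /\ normal_deriv nu phi x < 0) ->
  (forall x, bdry Om x -> u x = 0) ->
  exists C : R, forall x, Om x -> `|u x| <= C * phi x.
Proof.
move=> phi0 phib ub.
have [v [v1 _ _]] := W2_opp u.
have [C1 hC1] := Hopf_lower_bound _ _ phi0 phib ub.
have [|C2 hC2] := Hopf_lower_bound _ v phi0 phib.
  by move=> x bx; rewrite v1 ub// oppr0.
exists (Num.max C1 C2) => x Ox; rewrite ler_norml.
have := hC1 _ Ox; have := hC2 _ Ox; rewrite v1 opprK => h2 h1.
have m1 : C1 * phi x <= Num.max C1 C2 * phi x.
  by rewrite ler_wpM2r ?(ltW (phi0 _ Ox))// le_max lexx.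
have m2 : C2 * phi x <= Num.max C1 C2 * phi x.
  by rewrite ler_wpM2r ?(ltW (phi0 _ Ox))// le_max lexx orbT.
lra.
Qed.

End Hopf.

(** * The scalar inequalities *)

Section Powers.
Context {R : realType}.

Lemma spow_gt0E (gam w : R) : 0 < w -> spow gam w = w `^ gam.
Proof.
move=> w0; rewrite /spow; case: eqVneq => [->|g0]; first by rewrite powRr0.
rewrite gtr0_norm// -[X in _ * X](@powRr1 R)// ?ltW// -powRD ?subrK//.
by rewrite (negbTE g0).
Qed.

Lemma normr_spow (gam w : R) : `|spow gam w| = `|w| `^ gam.
Proof.
have [->|w0] := eqVneq w 0; last first.
  rewrite -spow_gt0E ?normr_gt0// /spow; case: ifP => _; first by rewrite normr1.
  by rewrite normrM normr_id ger0_norm// powR_ge0.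
rewrite /spow; case: eqVneq => [->|g0]; first by rewrite normr1 powRr0.
by rewrite mulr0 normr0 powR0.
Qed.

(** If [s] and [t] are positive, dividing by [s ^ alpha1] and [t ^ alpha2] gives
[s ^ (1 - alpha1) < t ^ beta1] and [t ^ (1 - alpha2) < s ^ beta2]; eliminating
[t] bounds [s ^ ((1 - alpha1) * (1 - alpha2))] strictly by [s ^ (beta1 * beta2)],
which is the same number. *)
Lemma coupled_powers_eq0 (alpha1 alpha2 beta1 beta2 r1 r2 s t : R) :
  alpha1 < 1 -> alpha2 < 1 -> 0 < beta1 -> 0 < beta2 ->
  beta1 * beta2 = (1 - alpha1) * (1 - alpha2) ->
  r1 < 1 -> r2 < 1 -> 0 <= s -> 0 <= t ->
  s <= r1 * (s `^ alpha1 * t `^ beta1) -> t <= r2 * (t `^ alpha2 * s `^ beta2) ->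
  s = 0 /\ t = 0.
Proof.
move=> a1 a2 b1 b2 bE r11 r21 s0 t0 hs ht.
have [sE|sn0] := eqVneq s 0.
  split=> //; apply/eqP; rewrite eq_le t0 andbT; apply: (le_trans ht).
  by rewrite sE powR0 ?gt_eqF// mulr0 mulr0.
have [tE|tn0] := eqVneq t 0.
  suff : s <= 0 by move: sn0; rewrite eq_le s0 andbT => /negP.
  by apply: (le_trans hs); rewrite tE powR0 ?gt_eqF// mulr0 mulr0.
have {sn0}s0 : 0 < s by rewrite lt_neqAle eq_sym sn0.
have {tn0}t0 : 0 < t by rewrite lt_neqAle eq_sym tn0.
have strict (r al be x y : R) : 0 < x -> 0 < y -> r < 1 ->
    x <= r * (x `^ al * y `^ be) -> x `^ (1 - al) < y `^ be.
  move=> x0 y0 r1' h; rewrite powRB ?powRr1 ?ltW//; last first.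
    by apply/implyP => _; rewrite gt_eqF.
  rewrite ltr_pdivrMr ?powR_gt0// mulrC; apply: (le_lt_trans h).
  by rewrite gtr_pMl// mulr_gt0// powR_gt0.
have hs' := strict _ _ _ _ _ s0 t0 r11 hs.
have ht' := strict _ _ _ _ _ t0 s0 r21 ht.
have h1 : (s `^ (1 - alpha1)) `^ (1 - alpha2) < (t `^ beta1) `^ (1 - alpha2).
  by apply: gt0_ltr_powR => //; rewrite ?nnegrE ?powR_ge0// subr_gt0.
have h2 : (t `^ (1 - alpha2)) `^ beta1 < (s `^ beta2) `^ beta1.
  by apply: gt0_ltr_powR => //; rewrite ?nnegrE ?powR_ge0.
rewrite powRAC in h2; have := lt_trans h1 h2.
by rewrite -!powRrM -bE mulrC ltxx.
Qed.

End Powers.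

(** * The principal curve *)

Section Curve.
Context {R : realType}.
Variables (alpha1 alpha2 beta1 beta2 Lambda0 : R).
Hypotheses (ha1 : alpha1 < 1) (ha2 : alpha2 < 1) (hb1 : 0 < beta1) (hb2 : 0 < beta2).
Hypothesis L0 : 0 < Lambda0.
Local Notation e1 := (Num.sqrt (beta1 * (1 - alpha1)))^-1.
Local Notation e2 := (Num.sqrt (beta2 * (1 - alpha2)))^-1.
Local Notation expr := (curve_expr alpha1 alpha2 beta1 beta2).
Local Notation R1 := (region1 alpha1 alpha2 beta1 beta2 Lambda0).

Let e1_gt0 : 0 < e1.
Proof. by rewrite invr_gt0 sqrtr_gt0 mulr_gt0// subr_gt0. Qed.

Let e2_gt0 : 0 < e2.
Proof. by rewrite invr_gt0 sqrtr_gt0 mulr_gt0// subr_gt0. Qed.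

Lemma curve_expr_gt0 l m : 0 < l -> 0 < m -> 0 < expr (l, m).
Proof. by move=> l0 m0; rewrite mulr_gt0// powR_gt0. Qed.

(** The expression of the curve is homogeneous of degree [e1 + e2], so every ray
of the open first quadrant meets the curve, at this multiple. *)
Lemma curve_expr_scale l m : 0 < l -> 0 < m ->
  let th := (Lambda0 / expr (l, m)) `^ (e1 + e2)^-1 in
  expr (th * l, th * m) = Lambda0.
Proof.
move=> l0 m0 th; have ex0 := curve_expr_gt0 _ _ l0 m0.
have th0 : 0 <= th by exact: powR_ge0.
rewrite /curve_expr/= !powRM ?(ltW l0) ?(ltW m0)// mulrACA -powRD; last first.
  by rewrite gt_eqF// addr_gt0.
rewrite /th -powRrM mulVf ?gt_eqF ?addr_gt0// powRr1; last by rewrite divr_ge0// ltW.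
by rewrite -/(expr (l, m)) divfK// gt_eqF.
Qed.

Lemma curve_expr_le l m l' m' : 0 <= l -> l <= l' -> 0 <= m -> m <= m' ->
  expr (l, m) <= expr (l', m').
Proof.
move=> l0 ll m0 mm; apply: ler_pM; rewrite ?powR_ge0//.
  by apply: ge0_ler_powR; rewrite ?nnegrE ?(ltW e1_gt0)// (le_trans l0).
by apply: ge0_ler_powR; rewrite ?nnegrE ?(ltW e2_gt0)// (le_trans m0).
Qed.

(** If the expression exceeded [Lambda0] at [(l, m)], the point [(th * l, th * m)] of
the curve would have smaller coordinates, and the quadrant above it would be a
neighbourhood of [(l, m)] disjoint from the region. *)
Lemma closure_region1 l m : closure R1 (l, m) ->
  [/\ 0 <= l, 0 <= m & 0 < l -> 0 < m -> expr (l, m) <= Lambda0].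
Proof.
move=> cl.
have near_meet (A B : set R) : nbhs l A -> nbhs m B ->
    exists x y, [/\ R1 (x, y), A x & B y].
  move=> lA mB; have [|[x y] [xy [/= Ax By]]] := cl (A `*` B).
    by exists (A, B).
  by exists x, y.
have nbhs_lt (x c : R) : x < c -> nbhs x [set y | y < c].
  by move=> xc; apply: open_nbhs_nbhs; split => //; exact: open_lt.
have nbhs_gt (x c : R) : c < x -> nbhs x [set y | c < y].
  by move=> xc; apply: open_nbhs_nbhs; split => //; exact: open_gt.
split.
- rewrite leNgt; apply/negP => l0.
  have [x [y [[/= x0 _ _] + _]]] := near_meet [set x | x < 0] setT (nbhs_lt _ _ l0) filterT.
  by move=> /= /(lt_trans x0); rewrite ltxx.
- rewrite leNgt; apply/negP => m0.
  have [x [y [[/= _ y0 _] _]]] := near_meet setT [set y | y < 0] filterT (nbhs_lt _ _ m0).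
  by move=> /= /(lt_trans y0); rewrite ltxx.
- move=> l0 m0; rewrite leNgt; apply/negP => Lex.
  pose th := (Lambda0 / expr (l, m)) `^ (e1 + e2)^-1.
  have q0 : 0 < Lambda0 / expr (l, m) by rewrite divr_gt0// curve_expr_gt0.
  have th0 : 0 < th by rewrite powR_gt0.
  have th1 : th < 1.
    have -> : 1 = 1 `^ (e1 + e2)^-1 :> R by rewrite powR1.
    apply: gt0_ltr_powR; rewrite ?nnegrE ?(ltW q0)//.
      by rewrite invr_gt0 addr_gt0.
    by rewrite ltr_pdivrMr ?mul1r// curve_expr_gt0.
  have [||x [y [[/= x0 y0] + lx my]]] := near_meet [set x | th * l < x] [set y | th * m < y].
  - by apply: nbhs_gt; rewrite gtr_pMl.
  - by apply: nbhs_gt; rewrite gtr_pMl.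
  apply/negP; rewrite -leNgt -[leLHS](curve_expr_scale _ _ l0 m0).
  by apply: curve_expr_le; rewrite ?mulr_ge0 ?ltW.
Qed.

(** On an axis, one coordinate of the curve point can be chosen freely and the
other one solves the equation of the curve; off the axes, move along the ray. *)
Lemma below_curve_dominated l m : closure R1 (l, m) ->
  ~ level_curve alpha1 alpha2 beta1 beta2 Lambda0 (l, m) ->
  exists l' m', [/\ level_curve alpha1 alpha2 beta1 beta2 Lambda0 (l', m'),
    `|l| < l' & `|m| < m'].
Proof.
move=> /closure_region1[l0 m0 lm] nlm.
rewrite (ger0_norm l0) (ger0_norm m0).
move: l0; rewrite le_eqVlt => /predU1P[l0|l0].
  have m1 : 0 < m + 1 by lra.
  have q0 : 0 < Lambda0 / (m + 1) `^ e2 by rewrite divr_gt0// powR_gt0.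
  exists ((Lambda0 / (m + 1) `^ e2) `^ e1^-1), (m + 1).
  rewrite -l0 powR_gt0//; split => //; last by rewrite ltrDl.
  split=> //=; first by rewrite powR_gt0.
  rewrite /curve_expr /= -powRrM mulVf ?gt_eqF// powRr1 ?(ltW q0)//.
  by rewrite divfK// gt_eqF// powR_gt0.
move: m0; rewrite le_eqVlt => /predU1P[m0|m0].
  have l1 : 0 < l + 1 by lra.
  have q0 : 0 < Lambda0 / (l + 1) `^ e1 by rewrite divr_gt0// powR_gt0.
  exists (l + 1), ((Lambda0 / (l + 1) `^ e1) `^ e2^-1).
  rewrite -m0 powR_gt0//; split => //; last by rewrite ltrDl.
  split=> //=; first by rewrite powR_gt0.
  rewrite /curve_expr /= -powRrM mulVf ?gt_eqF// powRr1 ?(ltW q0)//.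
  by rewrite mulrC divfK// gt_eqF// powR_gt0.
have {}lm : expr (l, m) < Lambda0.
  rewrite lt_neqAle lm// andbT; apply/eqP => h; apply: nlm; split => //.
pose th := (Lambda0 / expr (l, m)) `^ (e1 + e2)^-1.
have th1 : 1 < th.
  have -> : 1 = 1 `^ (e1 + e2)^-1 :> R by rewrite powR1.
  apply: gt0_ltr_powR; rewrite ?nnegrE//.
  - by rewrite invr_gt0 addr_gt0.
  - by rewrite divr_ge0// ltW// curve_expr_gt0.
  - by rewrite ltr_pdivlMr ?mul1r// curve_expr_gt0.
exists (th * l), (th * m); rewrite !ltr_pMl//; split=> //; split=> /=.
- by rewrite mulr_gt0// (lt_trans ltr01).
- by rewrite mulr_gt0// (lt_trans ltr01).
- exact: curve_expr_scale.
Qed.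

Lemma closure_region2 l m :
  closure (region2 alpha1 alpha2 beta1 beta2 Lambda0) (l, m) -> closure R1 (l, - m).
Proof.
move=> cl B [[A1 A2] /= [lA mA] AB].
have [|[x y] [xy [/= Ax Ay]]] := cl (A1 `*` [set y | A2 (- y)]).
  exists (A1, [set y | A2 (- y)]) => //=; split => //=.
  have : (fun y : R => - y) @ m --> - m by apply: cvgN; exact: cvg_id.
  exact.
by exists (x, - y); split => //; exact: AB.
Qed.

End Curve.

(** * Comparison through the weak maximum principle *)

#[local] Instance ae_lebesgueE_filter (R : realType) (n : nat) :
  Filter (nbhs (almost_everywhere (lebesgueE R n))).
Proof. exact: ae_filter_ringOfSetsType. Qed.

Section Comparison.
Context {R : realType} {n : nat}.
Local Notation E := 'rV[R]_n.+1.
Variables (Om : set E) (p : R).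
Hypotheses (oOm : open Om) (bOm : bounded_set Om) (p1 : 1 <= p).

Lemma op_app_linear (L : operator R n) (k : R) (u v w : W2 Om p) x :
  w x = k * u x + v x ->
  (forall i, w_grad w i x = k * w_grad u i x + w_grad v i x) ->
  (forall i j, w_hess w i j x = k * w_hess u i j x + w_hess v i j x) ->
  op_app L w x = k * op_app L u x + op_app L v x.
Proof.
move=> w0 w1 w2; rewrite /op_app w0.
have -> : \sum_i op_b L i x * w_grad w i x =
    k * \sum_i op_b L i x * w_grad u i x + \sum_i op_b L i x * w_grad v i x.
  by rewrite mulr_sumr -big_split; apply: eq_bigr => i _ /=; rewrite w1; ring.
have -> : \sum_i \sum_j op_a L i j x * w_hess w i j x =
    k * (\sum_i \sum_j op_a L i j x * w_hess u i j x) +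
    \sum_i \sum_j op_a L i j x * w_hess v i j x.
  rewrite mulr_sumr -big_split; apply: eq_bigr => i _ /=.
  rewrite mulr_sumr -big_split; apply: eq_bigr => j _ /=; rewrite w2; ring.
ring.
Qed.

Lemma ae_onS (P Q : E -> Prop) : (forall x, Om x -> P x -> Q x) ->
  ae_on Om P -> ae_on Om Q.
Proof. by move=> PQ; rewrite /ae_on; apply: filterS => x h Ox; exact/PQ/h. Qed.

Lemma ae_onI (P Q : E -> Prop) : ae_on Om P -> ae_on Om Q ->
  ae_on Om (fun x => P x /\ Q x).
Proof. by rewrite /ae_on; apply: filterS2 => x hP hQ Ox; split; [exact: hP|exact: hQ]. Qed.

Lemma weak_comparison (L : operator R n) (u phi : W2 Om p) (k : R) :
  weak_max_principle L Om p ->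
  (forall x, bdry Om x -> u x = 0 /\ phi x = 0) ->
  ae_on Om (fun x => `|op_app L u x| <= k * - op_app L phi x) ->
  forall x, Om x -> `|u x| <= k * phi x.
Proof.
move=> wmp ub uphi.
have one_side (v : W2 Om p) : (forall x, bdry Om x -> v x = 0) ->
    ae_on Om (fun x => op_app L v x <= k * - op_app L phi x) ->
    forall x, Om x -> 0 <= k * phi x + v x.
  move=> vb vphi x Ox.
  have [w [w0 w1 w2]] := W2_linear _ _ oOm bOm p1 k phi v.
  rewrite -w0; apply: wmp Ox; split; last first.
    by move=> y yb; rewrite w0 vb// (ub _ yb).2 mulr0 addr0.
  apply: ae_onS vphi => y _; rewrite (op_app_linear _ _ _ _ _ _ (w0 y))//; lra.
have [v [v0 v1 v2]] := W2_opp _ _ oOm bOm p1 u.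
have opv x : op_app L v x = - op_app L u x.
  rewrite (op_app_linear _ (-2) u u v x); [ring|..].
  - by rewrite v0; ring.
  - by move=> i; rewrite v1; ring.
  - by move=> i j; rewrite v2; ring.
move=> x Ox; rewrite ler_norml.
have h1 : 0 <= k * phi x + u x.
  apply: one_side => // [y yb|]; first by rewrite (ub _ yb).1.
  by apply: ae_onS uphi => y _; apply: le_trans; exact: ler_norm.
have h2 : 0 <= k * phi x + v x.
  apply: one_side => // [y yb|]; first by rewrite v0 (ub _ yb).1 oppr0.
  apply: ae_onS uphi => y _; apply: le_trans.
  by rewrite opv -normrN ler_norm.
by move: h2; rewrite v0; lra.
Qed.

(** The least constant is the supremum of [|u| / phi]; being least is what turns
an improved bound on [u] into an inequality between numbers. *)
Lemma best_dominating_constant (u phi : E -> R) (C : R) : Om !=set0 ->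
  (forall x, Om x -> 0 < phi x) -> (forall x, Om x -> `|u x| <= C * phi x) ->
  exists2 s : R, 0 <= s /\ forall x, Om x -> `|u x| <= s * phi x &
    forall s', (forall x, Om x -> `|u x| <= s' * phi x) -> s <= s'.
Proof.
move=> [x0 Ox0] phi0 hC.
pose S := [set `|u x| / phi x | x in Om].
have ubS s' : (forall x, Om x -> `|u x| <= s' * phi x) -> ubound S s'.
  by move=> h _ [x Ox <-]; rewrite ler_pdivrMr ?h// phi0.
have hS : has_sup S.
  by split; [exists (`|u x0| / phi x0), x0|exists C; exact: ubS].
have le_sup x : Om x -> `|u x| / phi x <= sup S.
  by move=> Ox; apply: ub_le_sup; [case: hS|exists x].
exists (sup S); last by move=> s' /ubS h; apply: ge_sup => //; case: hS.
split; last by move=> x Ox; rewrite -ler_pdivrMr ?le_sup// phi0.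
by apply: le_trans (le_sup _ Ox0); rewrite divr_ge0// ltW// phi0.
Qed.

Lemma ess_inf_gt0_ae (f : E -> R) : (0 < ess_inf_on Om f)%E ->
  ae_on Om (fun x => 0 < f x).
Proof.
move=> f0; rewrite /ae_on; have := ess_inf_le (lebesgueE R n) (patch (cst +oo%E) Om (EFin \o f)).
apply: filterS => x h Ox; have := lt_le_trans f0 h.
by rewrite /patch mem_set//= lte_fin.
Qed.

(** The bounds on [u] and [v] make the right-hand side for [u] at most the stated
constant times the one for [phi]; then apply [weak_comparison]. *)
Lemma equation_comparison (L : operator R n) (a : E -> R)
    (al be la la' s t : R) (u v phi psi : W2 Om p) :
  weak_max_principle L Om p -> 0 <= al -> 0 <= be -> 0 < la' -> 0 <= s -> 0 <= t ->
  ae_on Om (fun x => 0 < a x) ->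
  (forall x, Om x -> 0 < phi x /\ 0 < psi x) ->
  (forall x, bdry Om x -> u x = 0 /\ phi x = 0) ->
  ae_on Om (fun x => - op_app L u x = la * a x * spow al (u x) * spow be (v x)) ->
  ae_on Om (fun x => - op_app L phi x = la' * a x * spow al (phi x) * spow be (psi x)) ->
  (forall x, Om x -> `|u x| <= s * phi x) ->
  (forall x, Om x -> `|v x| <= t * psi x) ->
  forall x, Om x -> `|u x| <= `|la| / la' * (s `^ al * t `^ be) * phi x.
Proof.
move=> wmp al0 be0 la'0 s0 t0 a0 pos ub equ eqphi us vt.
apply: (weak_comparison _ _ _ _ wmp ub).
apply: ae_onS (ae_onI _ _ (ae_onI _ _ a0 equ) eqphi) => x Ox [[{}a0 {}equ] {}eqphi].
have [phi0 psi0] := pos _ Ox.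
rewrite -normrN equ eqphi !normrM !normr_spow (gtr0_norm a0) !spow_gt0E//.
have -> : `|la| / la' * (s `^ al * t `^ be) *
    (la' * a x * phi x `^ al * psi x `^ be) =
    `|la| * a x * (s * phi x) `^ al * (t * psi x) `^ be.
  rewrite !powRM ?(ltW phi0) ?(ltW psi0)//; field; by rewrite gt_eqF.
have pow_le (g y z : R) : 0 <= g -> `|y| <= z -> `|y| `^ g <= z `^ g.
  by move=> g0 yz; apply: ge0_ler_powR; rewrite ?nnegrE// (le_trans _ yz).
apply: ler_pM; rewrite ?mulr_ge0 ?powR_ge0// ?(ltW a0)//.
  by apply: ler_pM; rewrite ?mulr_ge0 ?powR_ge0 ?(ltW a0)// pow_le// us.
by rewrite pow_le// vt.
Qed.

End Comparison.

(** * The nonexistence result *)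

(** A principal eigenvalue [(la', mu')] excludes every eigenvalue whose
coordinates are strictly smaller in absolute value. *)
Lemma no_eigenvalue_below_principal {R : realType} {n : nat} (p : R) (Om : set 'rV[R]_n.+1)
    (nu : 'rV[R]_n.+1 -> 'rV[R]_n.+1) (L1 L2 : operator R n)
    (a b : 'rV[R]_n.+1 -> R) (alpha1 alpha2 beta1 beta2 la mu la' mu' : R) :
  open Om -> bounded_set Om -> 1 <= p -> outward_unit_normal Om nu ->
  weak_max_principle L1 Om p -> weak_max_principle L2 Om p ->
  strong_max_principle L1 Om p nu -> strong_max_principle L2 Om p nu ->
  ae_on Om (fun x => 0 < a x) -> ae_on Om (fun x => 0 < b x) ->
  0 < beta1 -> 0 < beta2 -> beta1 * beta2 = (1 - alpha1) * (1 - alpha2) ->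
  0 <= alpha1 < 1 -> 0 <= alpha2 < 1 ->
  system_principal_eigenvalue Om p L1 L2 a b alpha1 alpha2 beta1 beta2 (la', mu') ->
  `|la| < la' -> `|mu| < mu' ->
  ~ system_eigenvalue Om p L1 L2 a b alpha1 alpha2 beta1 beta2 (la, mu).
Proof.
move=> oOm bOm p1 hnu wmp1 wmp2 smp1 smp2 a0 b0 be1 be2 beE /andP[al1 al1'] /andP[al2 al2'].
move=> [phi [psi [[/= eqphi eqpsi bphi] _ pos]]] hla hmu.
move=> [u [v [[/= equ eqv buv] [x0 Ox0 ntr]]]].
have la'0 : 0 < la' by apply: le_lt_trans hla.
have mu'0 : 0 < mu' by apply: le_lt_trans hmu.
have Om0 : Om !=set0 by exists x0.
have Hopf_pos (L : operator R n) (f g : W2 Om p) (c : 'rV[R]_n.+1 -> R) (k al be : R) :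
    strong_max_principle L Om p nu -> 0 < k -> ae_on Om (fun x => 0 < c x) ->
    (forall x, Om x -> 0 < f x /\ 0 < g x) -> (forall x, bdry Om x -> f x = 0) ->
    ae_on Om (fun x => - op_app L f x = k * c x * spow al (f x) * spow be (g x)) ->
    forall x, bdry Om x -> f x = 0 /\ normal_deriv nu f x < 0.
  move=> smp k0 c0 fg0 fb eqf.
  have [|f0|[_ df] x xb] := smp f.
  - split=> [|x xb]; last by rewrite fb.
    apply: ae_onS (ae_onI _ _ _ c0 eqf) => x Ox [cx ex].
    have [fx gx] := fg0 _ Ox.
    rewrite -oppr_ge0 ex !spow_gt0E//.
    by rewrite !mulr_ge0 ?powR_ge0// ltW.
  - by have := (fg0 _ Ox0).1; rewrite f0// ltxx.
  - by split; [exact: fb|apply: df => //; exact: fb].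
have dphi := Hopf_pos _ _ _ _ _ _ _ smp1 la'0 a0 pos (fun x xb => (bphi x xb).1) eqphi.
have pos' x : Om x -> 0 < psi x /\ 0 < phi x by move=> /pos[].
have dpsi := Hopf_pos _ _ _ _ _ _ _ smp2 mu'0 b0 pos' (fun x xb => (bphi x xb).2) eqpsi.
have [C1 hC1] := Hopf_domination _ _ _ oOm bOm p1 hnu _ _
  (fun x Ox => (pos x Ox).1) dphi (fun x xb => (buv x xb).1).
have [C2 hC2] := Hopf_domination _ _ _ oOm bOm p1 hnu _ _
  (fun x Ox => (pos x Ox).2) dpsi (fun x xb => (buv x xb).2).
have [s [s0 us] smin] :=
  best_dominating_constant _ _ _ _ Om0 (fun x Ox => (pos x Ox).1) hC1.
have [t [t0 vt] tmin] :=
  best_dominating_constant _ _ _ _ Om0 (fun x Ox => (pos x Ox).2) hC2.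
have hs : s <= `|la| / la' * (s `^ alpha1 * t `^ beta1).
  apply: smin; apply: (equation_comparison Om p oOm bOm p1 L1 a _ _ _ _ _ _ u v phi psi) => //.
    exact: ltW.
  by move=> x xb; rewrite (buv x xb).1 (bphi x xb).1.
have ht : t <= `|mu| / mu' * (t `^ alpha2 * s `^ beta2).
  apply: tmin; apply: (equation_comparison Om p oOm bOm p1 L2 b _ _ _ _ _ _ v u psi phi) => //.
    exact: ltW.
  by move=> x xb; rewrite (buv x xb).2 (bphi x xb).2.
have [sE tE] : s = 0 /\ t = 0.
  apply: coupled_powers_eq0 al1' al2' be1 be2 beE _ _ s0 t0 hs ht.
    by rewrite ltr_pdivrMr// mul1r.
  by rewrite ltr_pdivrMr// mul1r.
have := us _ Ox0; have := vt _ Ox0; rewrite sE tE !mul0r !normr_le0 => /eqP v0 /eqP u0.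
by move: ntr; rewrite u0 v0 eqxx => -[].
Qed.

Theorem corollary1p4 (R : realType) (n : nat) (p : R) (hp : n.+1%:R < p)
    (Om : set 'rV[R]_n.+1) (nu : 'rV[R]_n.+1 -> 'rV[R]_n.+1)
    (hOm_open : open Om) (hOm_bounded : bounded_set Om)
    (hOm_C11 : C11_boundary Om) (hnu : outward_unit_normal Om nu)
    (L1 L2 : operator R n) (c0 C0 T : R)
    (hc0 : 0 < c0) (hC0 : 0 < C0) (hT : 0 < T)
    (hL1 : admissible Om c0 C0 T L1) (hL2 : admissible Om c0 C0 T L2)
    (hWMP1 : weak_max_principle L1 Om p) (hWMP2 : weak_max_principle L2 Om p)
    (hSMP1 : strong_max_principle L1 Om p nu)
    (hSMP2 : strong_max_principle L2 Om p nu)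
    (a b : 'rV[R]_n.+1 -> R)
    (ha : Lp_on Om p%:E a) (hb : Lp_on Om p%:E b)
    (ha_pos : (0 < ess_inf_on Om a)%E) (hb_pos : (0 < ess_inf_on Om b)%E)
    (alpha1 alpha2 beta1 beta2 : R)
    (hbeta1 : 0 < beta1) (hbeta2 : 0 < beta2)
    (hbeta : beta1 * beta2 = (1 - alpha1) * (1 - alpha2))
    (halpha1 : 0 <= alpha1 < 1) (halpha2 : 0 <= alpha2 < 1)
    (halpha : ~ (alpha1 = 0 /\ alpha2 = 0))
    (Lambda0 : R) (hLambda0 : 0 < Lambda0)
    (hC1 : system_principal_eigenvalue Om p L1 L2 a b alpha1 alpha2 beta1 beta2
           = level_curve alpha1 alpha2 beta1 beta2 Lambda0) :
  let C1 := system_principal_eigenvalue Om p L1 L2 a b alpha1 alpha2 beta1 beta2 in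
  let C2 := curve2 C1 in
  let R1 := region1 alpha1 alpha2 beta1 beta2 Lambda0 in
  let R2 := region2 alpha1 alpha2 beta1 beta2 Lambda0 in
  forall lm : R * R,
    ((closure R1 `\` C1) `|` opp_set (closure R1 `\` C1) `|`
     (closure R2 `\` C2) `|` opp_set (closure R2 `\` C2)) lm ->
    ~ system_eigenvalue Om p L1 L2 a b alpha1 alpha2 beta1 beta2 lm.
Proof.
move=> C1 C2 R1 R2 lm hlm.
have /andP[_ al1] := halpha1; have /andP[_ al2] := halpha2.
suff [la' [mu' [clm hla hmu]]] : exists la' mu', [/\ C1 (la', mu'),
    `|lm.1| < la' & `|lm.2| < mu'].
  have p1 : 1 <= p by rewrite (le_trans _ (ltW hp))// ler1n.
  rewrite (surjective_pairing lm).
  exact: (no_eigenvalue_below_principal p Om nu L1 L2 a b _ _ _ _ _ _ la' mu' hOm_open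
    hOm_bounded p1 hnu hWMP1 hWMP2 hSMP1 hSMP2 (ess_inf_gt0_ae _ _ ha_pos)
    (ess_inf_gt0_ae _ _ hb_pos)).
have dom1 (x : R * R) : (closure R1 `\` C1) x ->
    exists la' mu', [/\ C1 (la', mu'), `|x.1| < la' & `|x.2| < mu'].
  case: x => l m [clR NC1]; rewrite /C1 hC1.
  by apply: below_curve_dominated => //; rewrite -hC1.
have dom2 (x : R * R) : (closure R2 `\` C2) x ->
    exists la' mu', [/\ C1 (la', mu'), `|x.1| < la' & `|x.2| < mu'].
  case: x => l m [/closure_region2 clR NC2] /=.
  have [la' [mu' [clm hla hmu]]] := dom1 (l, - m) (conj clR NC2).
  by exists la', mu'; split=> //; rewrite -normrN.
case: hlm => [[[/dom1//|[x /dom1 hx <-]]|/dom2//]|[x /dom2 hx <-]];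
  by rewrite /= !normrN.
Qed.
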